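(* Let $G=(V,A)$ be a directed multigraph whose arcs are colored, let $r\in V$ be a root, and let $R\subseteq V\setminus\{r\}$ be a set of $k\ge 1$ terminals such that every terminal $v\in R$ has a monochromatic directed path $P_v$ from $v$ to $r$ in $G$. Then $G$ contains a $2\log_{4/3}k$-switching $r$-arborescence; that is, there is an $r$-arborescence $T\subseteq G$ containing every vertex of $R$ such that for every terminal $v\in R$, the unique directed path from $v$ to $r$ in $T$ switches colors at most $2\log_{4/3}k$ times. Moreover, such an arborescence can be computed in time polynomial in the size of $G$.
   Context: An $r$-arborescence in $G$ is a subgraph $T$ of $G$ in which every vertex of $T$ has a unique directed path in $T$ to $r$. A directed path is monochromatic if all its arcs have the same color. The number of color switches of a directed path $e_1,e_2,\dots,e_m$ (arcs in order) is the number of indices $j\in\{1,\dots,m-1\}$ such that $e_j$ and $e_{j+1}$ have different colors. An $r$-arborescence is called $\alpha$-switching (with respect to the terminal set $R$) if it contains all of $R$ and for every terminal $v\in R$ its path to $r$ in the arborescence has at most $\alpha$ color switches. *)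

(* Defs.v *)
From HB Require Import structures.
From mathcomp Require Import all_boot all_order all_algebra.
From mathcomp Require Import reals exp.

Set Implicit Arguments.
Unset Strict Implicit.
Unset Printing Implicit Defensive.

Import Order.TTheory GRing.Theory Num.Theory.

Record cdigraph (V A : finType) (C : eqType) := CDigraph {
  src : A -> V;
  tgt : A -> V;
  color : A -> C
}.

Section Arborescences.
Variables (V A : finType) (C : eqType).
Implicit Types (G : cdigraph V A C) (r v w : V) (p : seq A).

(* A directed path is the sequence of its arcs; [::] is the trivial path.
   Vertices may repeat, so that the uniqueness required in [arborescence] rules
   out every directed cycle of T: the unique path is then automatically simple,
   and r has no leaving arc in T. *)
Fixpoint dpath G v p w : bool :=
  if p is a :: p' then (src G a == v) && dpath G (tgt G a) p' w else v == w.

Definition monochromatic G p : bool := constant [seq color G a | a <- p].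

Definition switches G p : nat :=
  count (fun ab => color G ab.1 != color G ab.2) (zip p (behead p)).

Record subgraph := Subgraph { verts : {set V}; arcs : {set A} }.
Implicit Type T : subgraph.

Definition is_subgraph G T : Prop :=
  forall a, a \in arcs T -> src G a \in verts T /\ tgt G a \in verts T.

Definition dpath_in G T v p w : Prop :=
  [/\ v \in verts T, w \in verts T, {subset p <= arcs T} & dpath G v p w].

Definition arborescence G r T : Prop :=
  is_subgraph G T /\ forall v, v \in verts T -> exists! p, dpath_in G T v p r.

Definition alpha_switching (K : realType) (alpha : K) G r (R : {set V}) T :
    Prop :=
  [/\ arborescence G r T, R \subset verts T
    & forall v p, v \in R -> dpath_in G T v p r ->
        ((switches G p)%:R <= alpha)%R].

Definition valid_instance G r (R : {set V}) : Prop :=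
  [/\ r \notin R, 0 < #|R|
    & forall v, v \in R -> exists p, dpath G v p r /\ monochromatic G p].

End Arborescences.

(* Random access machine with finitely many (those named in the program) arrays
   of natural numbers, [s i j] being entry j of array i; scalar variables are
   entries at constant positions. One assignment or one test costs one unit.
   Arithmetic is limited to addition and truncated subtraction (no
   multiplication), so the bit length of the stored numbers grows at most
   linearly with the running time; unit cost is thus polynomially equivalent to
   Turing machine time. *)
Definition store := nat -> nat -> nat.

Inductive expr :=
  | Const of nat
  | Read of nat & expr
  | Plus of expr & expr
  | Minus of expr & expr.

Fixpoint eval (s : store) (e : expr) : nat :=
  match e with
  | Const c => c
  | Read i e1 => s i (eval s e1)
  | Plus e1 e2 => eval s e1 + eval s e2
  | Minus e1 e2 => eval s e1 - eval s e2
  end.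

Definition update (s : store) (i j x : nat) : store :=
  fun i' j' => if (i' == i) && (j' == j) then x else s i' j'.

Inductive cmd :=
  | Skip
  | Write of nat & expr & expr
  | Seq of cmd & cmd
  | If of expr & cmd & cmd
  | While of expr & cmd.

(* [exec c s t s']: started in s, c halts in s' after t units of time. Tests
   succeed on nonzero values. *)
Inductive exec : cmd -> store -> nat -> store -> Prop :=
  | exec_skip s : exec Skip s 1 s
  | exec_write s i e1 e2 :
      exec (Write i e1 e2) s 1 (update s i (eval s e1) (eval s e2))
  | exec_seq c1 c2 s t1 s1 t2 s2 :
      exec c1 s t1 s1 -> exec c2 s1 t2 s2 -> exec (Seq c1 c2) s (t1 + t2) s2
  | exec_if_true e c1 c2 s t s' :
      eval s e != 0 -> exec c1 s t s' -> exec (If e c1 c2) s t.+1 s'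
  | exec_if_false e c1 c2 s t s' :
      eval s e = 0 -> exec c2 s t s' -> exec (If e c1 c2) s t.+1 s'
  | exec_while_true e c s t1 s1 t2 s2 :
      eval s e != 0 -> exec c s t1 s1 -> exec (While e c) s1 t2 s2 ->
      exec (While e c) s (t1 + t2).+1 s2
  | exec_while_false e c s :
      eval s e = 0 -> exec (While e c) s 1 s.

Section Encoding.
Variables n m : nat.

(* Array 0 holds n, m and r; arrays 1, 2 and 3 the sources, targets and colors
   of the arcs; array 4 the characteristic vector of R. All the rest is 0. *)
Definition encode (G : cdigraph 'I_n 'I_m nat) (r : 'I_n) (R : {set 'I_n}) :
    store :=
  fun i => nth 0 (nth [::]
    [:: [:: n; m; val r];
        [seq val (src G a) | a <- enum 'I_m];
        [seq val (tgt G a) | a <- enum 'I_m];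
        [seq color G a | a <- enum 'I_m];
        [seq nat_of_bool (v \in R) | v <- enum 'I_n]] i).

(* The result is read as characteristic vectors: vertices in array 5, arcs in
   array 6. *)
Definition decode (s : store) : subgraph 'I_n 'I_m :=
  Subgraph [set v : 'I_n | s 5 v != 0] [set a : 'I_m | s 6 a != 0].

End Encoding.

(* Main.v *)
(* Fix for every terminal a color in which it reaches r, and for every color c
   an in-tree toward r in that color, spanning the set D_c of all vertices
   that reach r in color c. At most k colors are active at first. A token of
   weight 1 starts at every terminal, in the color of that terminal. As long as
   a color is active, deactivate one, c, whose tokens have least total weight:
   every vertex of D_c that lies in no active D_d is settled with its arc in
   the in-tree of c, and each token of color c walks along these arcs up to the
   first vertex that lies in some active D_d, where it takes the color d and
   doubles its weight, or up to r. Settled arcs form the arborescence.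
   With j >= 2 active colors one step multiplies the total weight by at most
   1 + 1/j, and the last step does not change it, so the final weight is at
   most k * 3/2 * 4/3 * ... * (k+1)/k = k(k+1)/2 <= k^2. A token that switches
   t times has weight 2^t, hence t <= 2 log_2 k <= 2 log_(4/3) k. *)

Require Import Defs.
From mathcomp Require Import all_boot all_order all_algebra.
From mathcomp Require Import reals exp.
From mathcomp Require Import zify lra.

Set Implicit Arguments.
Unset Strict Implicit.
Unset Printing Implicit Defensive.

Import Order.TTheory GRing.Theory Num.Theory.

(** * Structured programs *)

(* [For x j p] counts in cell 0 of array [x] up to the value of cell [j] of
   array 0. *)
Inductive prog :=
  | Nop
  | Do of nat & expr & expr
  | Then of prog & prog
  | Cond of expr & prog & prog
  | For of nat & nat & prog.

Fixpoint compile (p : prog) : cmd :=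
  match p with
  | Nop => Skip
  | Do i e1 e2 => Write i e1 e2
  | Then p1 p2 => Seq (compile p1) (compile p2)
  | Cond e p1 p2 => If e (compile p1) (compile p2)
  | For x j p1 =>
      Seq (Write x (Const 0) (Const 0))
        (While (Minus (Read 0 (Const j)) (Read x (Const 0)))
          (Seq (compile p1)
            (Write x (Const 0) (Plus (Read x (Const 0)) (Const 1)))))
  end.

Fixpoint mods (p : prog) : seq nat :=
  match p with
  | Nop => [::]
  | Do i _ _ => [:: i]
  | Then p1 p2 | Cond _ p1 p2 => mods p1 ++ mods p2
  | For x _ p1 => x :: mods p1
  end.

(** Array 0 is read-only, so loop bounds stay fixed, and no body writes the array of its own
    counter. Under these conditions [den] describes the compiled code faithfully. *)
Fixpoint wfprog (p : prog) : bool :=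
  match p with
  | Nop => true
  | Do i _ _ => i != 0
  | Then p1 p2 | Cond _ p1 p2 => wfprog p1 && wfprog p2
  | For x _ p1 => [&& x != 0, x \notin mods p1 & wfprog p1]
  end.

Fixpoint den (p : prog) (s : store) : store :=
  match p with
  | Nop => s
  | Do i e1 e2 => update s i (eval s e1) (eval s e2)
  | Then p1 p2 => den p2 (den p1 s)
  | Cond e p1 p2 => if eval s e != 0 then den p1 s else den p2 s
  | For x j p1 =>
      iteri (s 0 j) (fun k u => update (den p1 u) x 0 k.+1) (update s x 0 0)
  end.

(** The variable stands for a bound on the cells of array 0. A conditional adds both branches, since
    a maximum would not be a polynomial. Each round of a loop pays for its test and increment; the
    outer 2 is the reset and the final failing test. *)
Fixpoint cost (p : prog) : {poly nat} :=
  match p with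
  | Nop | Do _ _ _ => 1%R
  | Then p1 p2 => (cost p1 + cost p2)%R
  | Cond _ p1 p2 => (cost p1 + cost p2 + 1)%R
  | For _ _ p1 => (2%:P + 'X * (cost p1 + 2%:P))%R
  end.

Lemma updateE s i j x i' j' :
  update s i j x i' j' = if (i' == i) && (j' == j) then x else s i' j'.
Proof. by []. Qed.

Lemma update_frame s i j x i' : i' != i -> update s i j x i' = s i'.
Proof. by rewrite /update => /negPf->. Qed.

Lemma den_frame p s i : i \notin mods p -> den p s i = s i.
Proof.
elim: p s => [|i' e1 e2|p1 IH1 p2 IH2|e p1 IH1 p2 IH2|x j p IH] s //=.
- by rewrite inE; apply: update_frame.
- by rewrite mem_cat negb_or => /andP[h1 h2]; rewrite IH2 ?IH1.
- by rewrite mem_cat negb_or => /andP[h1 h2]; case: ifP => _; rewrite ?IH2 ?IH1.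
rewrite inE negb_or => /andP[hx hp].
elim: (s 0 j) => [|k IHk] /=; first exact: update_frame.
by rewrite update_frame // IH.
Qed.

Lemma iteri_frame x p k s i : i != x -> i \notin mods p ->
  iteri k (fun k u => update (den p u) x 0 k.+1) (update s x 0 0) i = s i.
Proof.
move=> hx hp; elim: k => [|k IHk] /=; first exact: update_frame.
by rewrite update_frame // den_frame.
Qed.

Lemma iteri_counter x p k s :
  iteri k (fun k u => update (den p u) x 0 k.+1) (update s x 0 0) x 0 = k.
Proof. by case: k => [|k] /=; rewrite updateE !eqxx. Qed.

Lemma wfprog_mods p : wfprog p -> 0 \notin mods p.
Proof.
elim: p => [|i e1 e2|p1 IH1 p2 IH2|e p1 IH1 p2 IH2|x j p IH] //=.
- by rewrite inE eq_sym.
- by case/andP=> /IH1 h1 /IH2 h2; rewrite mem_cat negb_or h1.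
- by case/andP=> /IH1 h1 /IH2 h2; rewrite mem_cat negb_or h1.
by case/and3P=> x0 _ /IH h; rewrite inE negb_or eq_sym x0.
Qed.

(** The invariant rule for loops; the frame hypothesis passes on whatever the starting store holds
    outside the arrays written by the loop. *)
Lemma for_ind (I : nat -> store -> Prop) N x j p s :
    s 0 j = N -> wfprog (For x j p) ->
    I 0 (update s x 0 0) ->
    (forall k u, k < N ->
      (forall i, i \notin mods (For x j p) -> u i = s i) ->
      u x 0 = k -> I k u -> I k.+1 (update (den p u) x 0 k.+1)) ->
  I N (den (For x j p) s).
Proof.
move=> <- /= /and3P[x0 xp wp] I0 IS.
suff H k : k <= s 0 j -> I k (iteri k (fun k u => update (den p u) x 0 k.+1)
    (update s x 0 0)) by apply: H.
elim: k => [|k IHk] //= lek.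
apply: IS => //; last by apply: IHk; apply: ltnW.
- by move=> i; rewrite inE negb_or => /andP[? ?]; apply: iteri_frame.
- exact: iteri_counter.
Qed.

Lemma exec_compile N p s : wfprog p -> (forall j, s 0 j <= N) ->
  exists2 t, exec (compile p) s t (den p s) & t <= (cost p).[N]%R.
Proof.
elim: p s => [|i e1 e2|p1 IH1 p2 IH2|e p1 IH1 p2 IH2|x j p IH] s /=.
- by exists 1; [constructor | rewrite hornerC].
- by exists 1; [constructor | rewrite hornerC].
- case/andP=> w1 w2 hN; rewrite hornerD.
  have [t1 e1 l1] := IH1 _ w1 hN.
  have [|t2 e2 l2] := IH2 (den p1 s) w2.
    by move=> j; rewrite den_frame // wfprog_mods.
  by exists (t1 + t2); [apply: exec_seq e1 e2 | apply: leq_add].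
- case/andP=> w1 w2 hN; rewrite !hornerD hornerC.
  have [t1 e1 l1] := IH1 _ w1 hN.
  have [t2 e2 l2] := IH2 _ w2 hN.
  have [he|/eqP he] := boolP (eval s e == 0) => /=.
    exists t2.+1; first by apply: exec_if_false e2; apply/eqP.
    by move: l2; rewrite /GRing.add /GRing.one /=; lia.
  exists t1.+1; first by apply: exec_if_true e1; apply/eqP.
  by move: l1; rewrite /GRing.add /GRing.one /=; lia.
case/and3P=> x0 xp wp hN.
set W := While _ _; set T := (cost p).[N]%R.
pose it k := iteri k (fun k u => update (den p u) x 0 k.+1) (update s x 0 0).
have it0 k : it k 0 = s 0.
  by apply: iteri_frame; [rewrite eq_sym | apply: wfprog_mods].
have itx k : it k x 0 = k by apply: iteri_counter.
(* Induction on the number [d] of remaining rounds, because [While] unfolds from the front. *)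
have hW d k : k + d = s 0 j ->
    exists2 t, exec W (it k) t (it (s 0 j)) & t <= d * (T + 2) + 1.
  elim: d k => [|d IHd] k hk.
    rewrite addn0 in hk; rewrite -hk; exists 1 => //.
    by apply: exec_while_false; rewrite /= it0 itx hk subnn.
  have [|t1 e1 l1] := IH (it k) wp; first by move=> l; rewrite it0.
  have [|t2 e2 l2] := IHd k.+1; first by rewrite -hk addSnnS.
  exists (t1 + 1 + t2).+1; last by rewrite -/T in l1; nia.
  apply: exec_while_true e2.
    by rewrite /= it0 itx -hk addKn.
  apply: exec_seq e1 _.
  have -> : it k.+1 = update (den p (it k)) x
      (eval (den p (it k)) (Const 0))
      (eval (den p (it k)) (Plus (Read x (Const 0)) (Const 1))).
    by rewrite /= den_frame // itx addn1.
  exact: exec_write.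
have [//|t et lt] := hW (s 0 j) 0.
exists (1 + t); first by apply: exec_seq et; apply: exec_write.
rewrite !(hornerD, hornerM, hornerX, hornerC) -/T.
move: lt (hN j); rewrite /GRing.add /GRing.mul /=; nia.
Qed.

(** * Elimination of colors *)

Definition seq_switches (C : eqType) (cs : seq C) : nat :=
  count (fun cd => cd.1 != cd.2) (zip cs (behead cs)).

Lemma seq_switches_rcons2 (C : eqType) (cs : seq C) c d :
  seq_switches (rcons (rcons cs c) d) = seq_switches (rcons cs c) + (c != d).
Proof.
rewrite /seq_switches; elim: cs => [|x cs IH] /=; first by rewrite addn0.
by case: cs IH => [|y cs] /= IH; rewrite IH addnA.
Qed.

Lemma seq_switches_rcons (C : eqType) (cs : seq C) c :
  seq_switches cs <= seq_switches (rcons cs c).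
Proof.
by case/lastP: cs => [|cs d] //; rewrite seq_switches_rcons2 leq_addr.
Qed.

(** Arcs in the color already appended are free: this accounts for a token walking inside its
    in-tree. *)
Lemma seq_switches_const (C : eqType) (cs ds : seq C) c : all (pred1 c) ds ->
  seq_switches (rcons (cs ++ ds) c) = seq_switches (rcons cs c).
Proof.
elim: ds cs => [|d ds IH] cs /=; first by rewrite cats0.
case/andP=> /eqP-> hds.
by rewrite -cat_rcons IH // seq_switches_rcons2 eqxx addn0.
Qed.

(** Only the last pair is affected; this is the price of a token changing its color. *)
Lemma seq_switches_change (C : eqType) (cs : seq C) c d :
  seq_switches (rcons cs d) <= (seq_switches (rcons cs c)).+1.
Proof.
case/lastP: cs => [|cs x] //; rewrite !seq_switches_rcons2.
by case: (x != c); case: (x != d); lia.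
Qed.

(* Replace [rho] by the number of elements of smaller rank. *)
Lemma bounded_rank n (P : nat -> nat -> Prop) (rho : nat -> nat) :
  (forall y z, y < n -> z < n -> P y z -> rho z < rho y) ->
  exists2 rho' : nat -> nat, (forall y, y < n -> rho' y < n) &
    forall y z, y < n -> z < n -> P y z -> rho' z < rho' y.
Proof.
move=> h; exists (fun y => #|[set z : 'I_n | rho z < rho y]|).
  move=> y yn.
  rewrite -[X in _ < X]card_ord -cardsT; apply: proper_card; apply/properP.
  by split; [apply: subsetT | exists (Ordinal yn); rewrite !inE ?ltnn].
move=> y z yn zn /(h y z yn zn) lt; apply: proper_card; apply/properP; split.
  by apply/subsetP=> x; rewrite !inE => /ltn_trans; apply.
by exists (Ordinal zn); rewrite !inE ?ltnn.
Qed.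

Section Elimination.
Variables (n m r : nat) (sr tg co : nat -> nat).
Hypothesis r_lt : r < n.
Hypothesis sr_lt : forall a, a < m -> sr a < n.
Hypothesis tg_lt : forall a, a < m -> tg a < n.

(* [out v] is a.+1 for the arc a leaving v, and 0 if there is none. *)
Fixpoint follows (out : nat -> nat) (v : nat) (p : seq nat) (w : nat) : bool :=
  if p is a :: p' then
    [&& a < m, sr a == v, out v == a.+1 & follows out (tg a) p' w]
  else v == w.

Lemma follows_cat out v p w q x :
  follows out v p w -> follows out w q x -> follows out v (p ++ q) x.
Proof.
elim: p v => [|a p IH] v /=; first by move=> /eqP->.
by case/and4P=> -> -> -> /IH h /h ->.
Qed.

Lemma follows_sub (out out' : nat -> nat) v p w :
    (forall y, y < n -> out y != 0 -> out' y = out y) ->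
  follows out v p w -> follows out' v p w.
Proof.
move=> ho; elim: p v => [|a p IH] v //=.
case/and4P=> am /eqP sa /eqP oa /IH ->.
by rewrite am sa ho ?oa ?eqxx // -sa sr_lt.
Qed.

(* [f] encodes, as [out] does, an in-tree toward r in the color of the arc b;
   [rho] excludes cycles. *)
Definition row_ok (f : nat -> nat) b := exists rho : nat -> nat,
  forall y, y < n -> f y != 0 ->
    [/\ (f y).-1 < m, sr (f y).-1 = y, co (f y).-1 = co b, y != r
      & let z := tg (f y).-1 in z = r \/ f z != 0 /\ rho z < rho y].

Definition live (nx : nat -> nat -> nat) (act : nat -> nat) y :=
  exists b, [/\ b < m, act b != 0 & nx b y != 0].

Variable nx : nat -> nat -> nat.
Hypothesis nx_ok : forall b, b < m -> row_ok (nx b) b.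

(* A color is represented by an arc b of that color, and [nx b] is its in-tree.
   [cls v] is b.+1 if the token started at v has color b, and 0 once the token
   has reached r; [w v] is 0 if v is not a terminal. The next arc of a token of
   color b has color b, which is why that color is appended to the colors of the
   arcs already used. *)
Record elim_inv (k : nat) (act out pos cls w : nat -> nat) : Prop := ElimInv {
  inv_act : forall b, b < m -> act b <= 1;
  inv_out : forall y, y < n -> out y != 0 -> exists2 b, b < m & out y = nx b y;
  inv_live : forall y, y < n -> live nx act y -> out y = 0;
  inv_path : forall y, y < n -> out y != 0 ->
    exists p z, [/\ z < n, follows out y p z & z = r \/ live nx act z];
  inv_tok : forall v, v < n -> w v != 0 ->
    exists p, [/\ pos v < n, follows out v p (pos v) &
      if cls v is b.+1 then
        [/\ b < m, act b != 0, nx b (pos v) != 0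
          & 2 ^ seq_switches (rcons (map co p) (co b)) <= w v]
      else pos v = r /\ 2 ^ seq_switches (map co p) <= w v];
  inv_cls : forall v, v < n -> w v = 0 -> cls v = 0;
  inv_pot : (\sum_(v < n) w v) * (maxn (\sum_(b < m) act b) 1).+1 <= k * k.+1
}.

(** The index is a value of [cls], so the load of the color [c] is found at [c.+1]. *)
Definition load (cls w : nat -> nat) b := \sum_(v < n | cls v == b) w v.

Definition walk_step (lv out : nat -> nat) y :=
  if lv y != 0 then y else if y == r then y else tg (out y).-1.

Lemma iter_fix (T : Type) (f : T -> T) k x : f x = x -> iter k f x = x.
Proof. by move=> h; elim: k => //= k ->. Qed.

(** * One elimination step *)

Section Step.
Variables (k : nat) (act out pos cls w : nat -> nat).
Hypothesis inv : elim_inv k act out pos cls w.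
(* [lv y] is b.+1 for some active b whose in-tree contains y, or 0. *)
Variables (c : nat) (act' out' pos' cls' w' lv : nat -> nat).
Hypothesis c_lt : c < m.
Hypothesis act_c : act c != 0.
Hypothesis load_min : forall b, b < m -> act b != 0 ->
  load cls w c.+1 <= load cls w b.+1.
Hypothesis act'E : forall b, b < m -> act' b = if b == c then 0 else act b.
Hypothesis lvE : forall y, y < n ->
  if lv y is b.+1 then [/\ b < m, act' b != 0 & nx b y != 0]
  else ~ live nx act' y.
Hypothesis out'E : forall y, y < n ->
  out' y = if (nx c y != 0) && (lv y == 0) then nx c y else out y.
Hypothesis tok_c : forall v, v < n -> cls v = c.+1 ->
  [/\ pos' v = iter n (walk_step lv out') (pos v), cls' v = lv (pos' v)
    & w' v = if lv (pos' v) != 0 then w v + w v else w v].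
Hypothesis tok_nc : forall v, v < n -> cls v != c.+1 ->
  [/\ pos' v = pos v, cls' v = cls v & w' v = w v].

Lemma lv_live y : y < n -> lv y != 0 -> live nx act' y.
Proof. by move=> /lvE; case: (lv y) => // b h _; exists b. Qed.

(** A settled vertex is not live, whereas every vertex in the in-tree of the active color [c] is;
    hence settled arcs are never overwritten. *)
Lemma out'_sub y : y < n -> out y != 0 -> out' y = out y.
Proof.
move=> yn oy; rewrite out'E //; case: ifP => // /andP[h _].
by rewrite (inv_live inv yn) // in oy; exists c.
Qed.

Lemma live_sub y : live nx act' y -> live nx act y.
Proof.
by case=> b [bm ab nb]; exists b; split=> //; move: ab; rewrite act'E //;
  case: ifP.
Qed.

(** Until the walk meets a live vertex or [r], [out'] agrees with the in-tree of [c], along which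
    the rank drops. With ranks below [n], [n] steps are enough. *)
Lemma walk_end y : y < n -> y = r \/ nx c y != 0 ->
  exists p, let z := iter n (walk_step lv out') y in
    [/\ z < n, follows out' y p z, all (pred1 (co c)) (map co p)
      & z = r \/ lv z != 0].
Proof.
have [rho hrho] := nx_ok c_lt.
pose P y z := nx c y != 0 /\ z = tg (nx c y).-1 /\ z != r.
have [|rho' rho'_lt rho'P] := @bounded_rank n P rho.
  move=> y' z y'n zn [ny [-> zr]].
  by case: (hrho y' y'n ny) => _ _ _ _ [e|[]//]; rewrite e eqxx in zr.
move=> yn hy.
suff H d x : x < n -> x = r \/ nx c x != 0 /\ rho' x < d ->
  exists p, let z := iter d (walk_step lv out') x in
    [/\ z < n, follows out' x p z, all (pred1 (co c)) (map co p)
      & z = r \/ lv z != 0].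
  by apply: H => //; case: hy => [|hy]; [left | right; rewrite rho'_lt].
(* The root and the vertices with nonzero [lv] are fixed points, so surplus steps do nothing. *)
have stop d' x' : x' < n -> x' = r \/ lv x' != 0 ->
  exists p, let z := iter d' (walk_step lv out') x' in
    [/\ z < n, follows out' x' p z, all (pred1 (co c)) (map co p)
      & z = r \/ lv z != 0].
  move=> xn hx; exists [::] => /=.
  rewrite iter_fix /=; first by rewrite eqxx.
  by rewrite /walk_step; case: hx => [->|->] //; rewrite eqxx if_same.
elim: d x => [|d IH] x xn hx.
  by apply: (stop 0) => //; case: hx => [|[]]; auto.
have [lx|lx] := boolP (lv x != 0); first by apply: (stop d.+1) => //; right.
case: hx => [hx|[nc rx]]; first by apply: (stop d.+1) => //; left.
rewrite negbK in lx.
have [am sa ca xr hz] := hrho x xn nc.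
have ox : out' x = nx c x by rewrite out'E // nc lx.
have zn : tg (nx c x).-1 < n by apply: tg_lt.
have sx : walk_step lv out' x = tg (nx c x).-1.
  by rewrite /walk_step lx /= (negPf xr) ox.
rewrite iterSr sx.
have [|p [zn' fp cp ep]] := IH (tg (nx c x).-1) zn.
  have [->|zr] := eqVneq (tg (nx c x).-1) r; first by left.
  case: hz => [|[nz _]]; first by left.
  right; split=> //; suff : rho' (tg (nx c x).-1) < rho' x by lia.
  by apply: rho'P => //; split.
exists ((nx c x).-1 :: p); split=> //=.
  by rewrite am sa eqxx ox prednK ?lt0n // eqxx.
by rewrite ca eqxx.
Qed.

(** The minimum is at most the average: each token counts for at most one color, since [cls] takes a
    single value. *)
Lemma load_card : load cls w c.+1 * (\sum_(b < m) act b) <= \sum_(v < n) w v.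
Proof.
rewrite big_distrr /=.
apply: (@leq_trans (\sum_(b < m) load cls w b.+1)).
  apply: leq_sum => b _; have := inv_act inv (ltn_ord b).
  case ab: (act b) => [|[|//]] _; rewrite ?muln0 // muln1.
  by apply: load_min => //; rewrite ab.
rewrite /load (eq_bigr (fun b : 'I_m =>
    \sum_(v < n) if cls v == b.+1 then w v else 0));
  last by move=> b _; rewrite big_mkcond.
rewrite exchange_big /=; apply: leq_sum => v _.
rewrite -big_mkcond sum_nat_const -[X in _ <= X]mul1n leq_mul2r.
apply/orP; right; apply/card_le1_eqP => x y; rewrite !unfold_in => /eqP hx /eqP.
by rewrite hx => -[] /val_inj.
Qed.

Lemma sum_act : \sum_(b < m) act b = (\sum_(b < m) act' b).+1.
Proof.
rewrite (bigD1 (Ordinal c_lt)) //= [in RHS](bigD1 (Ordinal c_lt)) //=.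
rewrite act'E // eqxx add0n.
have -> : act c = 1 by move: (inv_act inv c_lt) act_c; case: (act c) => [|[]].
rewrite add1n; congr _.+1; apply: eq_bigr => b hb.
by rewrite act'E //; case: ifP => // /eqP e; case/eqP: hb; apply: val_inj.
Qed.

Lemma elim_step : elim_inv k act' out' pos' cls' w'.
Proof.
have pos_c v : v < n -> w v != 0 -> cls v = c.+1 ->
    pos v < n /\ nx c (pos v) != 0.
  by move=> vn wv cv; case: (inv_tok inv vn wv) => p []; rewrite cv => ? _ [].
split.
- by move=> b bm; rewrite act'E //; case: ifP => // _; apply: (inv_act inv bm).
- move=> y yn; rewrite out'E //; case: ifP => [_ _|_]; first by exists c.
  exact: (inv_out inv yn).
- move=> y yn ly; rewrite out'E //; case: ifP => [/andP[_ /eqP l0]|_].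
    by have := lvE yn; rewrite l0.
  by apply: (inv_live inv yn); apply: live_sub.
(* A vertex live through a color other than [c] stays live; from one live through [c], the walk in
   its in-tree extends the path. *)
- have fin z : z < n -> z = r \/ live nx act z ->
      exists p z', [/\ z' < n, follows out' z p z' & z' = r \/ live nx act' z'].
    move=> zn [->|[b [bm ab nb]]].
      by exists [::], r; split=> //=; left.
    have [e|bc] := eqVneq b c; last first.
      exists [::], z; split=> //=; right.
      by exists b; rewrite act'E // (negPf bc).
    have [|p [h1 h2 _ h4]] := walk_end zn; first by right; rewrite -e.
    exists p; eexists; split; [exact: h1 | exact: h2 |].
    by case: h4 => [|/(lv_live h1)]; [left | right].
  move=> y yn oy'.
  have [oy|oy] := boolP (out y != 0).
    have [p [z [zn fp hz]]] := inv_path inv yn oy.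
    have [q [z' [z'n fq hz']]] := fin z zn hz.
    exists (p ++ q), z'; split=> //; apply: follows_cat fq.
    exact: follows_sub out'_sub fp.
  (* A newly settled vertex lies in the in-tree of [c] and was therefore live before. *)
  apply: fin => //; right; exists c; split=> //; move: oy'; rewrite out'E //.
  by case: ifP => [/andP[]|_ oy'] //; rewrite oy' in oy.
- move=> v vn; have [cv|cv] := eqVneq (cls v) c.+1; last first.
    have [-> -> ->] := tok_nc vn cv => wv.
    have [p [pn fp h]] := inv_tok inv vn wv.
    exists p; split=> //; first exact: follows_sub out'_sub fp.
    move: cv h; case: (cls v) => // b cv [bm ab nb h]; split=> //.
    by rewrite act'E //; case: ifP => // /eqP e; rewrite e eqxx in cv.
  have [pE cE wE] := tok_c vn cv; rewrite cE wE => wv'.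
  have wv : w v != 0 by move: wv'; case: ifP => // _; rewrite addn_eq0 andbb.
  have [p [pn fp]] := inv_tok inv vn wv.
  rewrite cv => -[_ _ nc hw].
  have [|q [qn fq cq hq]] := walk_end pn; first by right.
  rewrite -pE in qn fq hq.
  exists (p ++ q); split=> //.
    by apply: follows_cat fq; apply: follows_sub out'_sub fp.
  (* If no active in-tree contains the end of the walk, that end is [r], and dropping the appended
     color adds no switch. Otherwise the doubled weight pays for one more switch. *)
  have := lvE qn; case: (lv (pos' v)) hq => [|b] hq /=.
    move=> _; split; first by case: hq.
    apply: leq_trans hw; rewrite leq_exp2l // map_cat.
    by rewrite -(seq_switches_const _ cq) seq_switches_rcons.
  move=> [bm ab nb]; split=> //; rewrite addnn -mul2n.
  apply: (@leq_trans (2 ^ (seq_switches (rcons (map co p) (co c))).+1));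
    last first.
    by rewrite expnS leq_mul2l.
  by rewrite leq_exp2l // map_cat -(seq_switches_const (map co p) cq)
    seq_switches_change.
- move=> v vn; have [cv|cv] := eqVneq (cls v) c.+1; last first.
    by have [_ -> ->] := tok_nc vn cv; apply: (inv_cls inv vn).
  have [_ _ wE] := tok_c vn cv; rewrite wE => wv.
  have /(inv_cls inv vn) : w v = 0 by move: wv; case: ifP => // _; lia.
  by rewrite cv.
(* Only tokens of color [c] can double, so the gain is at most the load of [c]. *)
have le1 : \sum_(v < n) w' v <= \sum_(v < n) w v + load cls w c.+1.
  rewrite /load [X in _ + X]big_mkcond -big_split /=; apply: leq_sum => v _.
  have [cv|cv] := eqVneq (cls v) c.+1;
    last by have [_ _ ->] := tok_nc (ltn_ord v) cv; lia.
  by have [_ _ ->] := tok_c (ltn_ord v) cv; case: ifP => _; lia.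
have := inv_pot inv; have := load_card; rewrite sum_act.
(* Let W and W' be the total weights before and after. If [j.+1] colors remain, averaging gives W'
   (j+2) <= W (j+3), which preserves the potential bound. If none remains, the factor is 2 both
   before and after, so the weight must not grow: with no live vertex, no token of positive weight
   doubles. *)
case s0: (\sum_(b < m) act' b) => [|j]; last by nia.
suff -> : \sum_(v < n) w' v = \sum_(v < n) w v by [].
apply: eq_bigr => v _.
have [cv|cv] := eqVneq (cls v) c.+1; last by have [] := tok_nc (ltn_ord v) cv.
have [pE _ ->] := tok_c (ltn_ord v) cv.
have [->|wv] := eqVneq (w v) 0; first by case: ifP.
case: ifP => // lvn0.
have [pn nc] := pos_c v (ltn_ord v) wv cv.
have [|q [qn _ _ _]] := walk_end pn; first by right.
rewrite -pE in qn.
have := lvE qn; case: (lv (pos' v)) lvn0 => // b _ [bm ab nb].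
by move/eqP: s0; rewrite sum_nat_eq0 => /forallP/(_ (Ordinal bm)) /=;
  rewrite (negPf ab).
Qed.

End Step.
End Elimination.

(** * The algorithm *)

(* Arrays 0 to 6 are those of the input and of the output, array 5 also serving
   as [out]. The others are:
     7   b * n, at position b
     8   nx b y, at position b * n + y
     9   act        10  cls        11  pos        12  w
     13  loads, at position b.+1
     14  c.+1 for the color c to be deactivated, or 0
     15  lv
     20 to 24  loop counters *)
Definition cell i := Read i (Const 0).
Definition succ_expr e := Plus e (Const 1).
Definition pred_expr e := Minus e (Const 1).
(** With truncated subtraction this is the distance of the two values, zero exactly when they
    agree. *)
Definition neq_expr e f := Plus (Minus e f) (Minus f e).

Lemma neq_exprE s e f : (eval s (neq_expr e f) != 0) = (eval s e != eval s f).
Proof. by rewrite /=; apply/idP/idP; lia. Qed.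

Lemma denC e p q s :
  den (Cond e p q) s = if eval s e != 0 then den p s else den q s.
Proof. by []. Qed.

Lemma denT p q s : den (Then p q) s = den q (den p s).
Proof. by []. Qed.

Lemma denD i e1 e2 s : den (Do i e1 e2) s = update s i (eval s e1) (eval s e2).
Proof. by []. Qed.

Lemma denN s : den Nop s = s.
Proof. by []. Qed.

Definition denE := (denC, denT, denD, denN).
Arguments den : simpl never.

Local Notation root_expr := (Read 0 (Const 2)).
Local Notation vb := (cell 20).
Local Notation vk := (cell 21).
Local Notation vv := (cell 22).
Local Notation va := (cell 23).
Local Notation best := (cell 14).
Local Notation next_expr b y := (Read 8 (Plus (Read 7 b) y)).

(** * Monochromatic in-trees by relaxation of arcs *)

Definition offsets :=
  For 20 1 (Do 7 (succ_expr vb) (Plus (Read 7 vb) (Read 0 (Const 0)))).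

(** A relaxation in the style of Bellman and Ford, with nested tests in place of a conjunction. The
    truncated difference of 1 and a distance is an equality test. *)
Definition relax :=
  Cond (neq_expr (Read 3 va) (Read 3 vb)) Nop
  (Cond (next_expr vb (Read 1 va)) Nop
  (Cond (neq_expr (Read 1 va) root_expr)
    (Cond (Plus (next_expr vb (Read 2 va))
             (Minus (Const 1) (neq_expr (Read 2 va) root_expr)))
       (Do 8 (Plus (Read 7 vb) (Read 1 va)) (succ_expr va)) Nop)
    Nop)).

Definition reach_color := For 21 0 (For 23 1 relax).
Definition reach_all := For 20 1 reach_color.

Section ReachPrograms.
Variables (n m r : nat) (sr tg co : nat -> nat).
Hypothesis sr_lt : forall a, a < m -> sr a < n.
Hypothesis tg_lt : forall a, a < m -> tg a < n.

Record reads (s : store) : Prop := Reads {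
  reads_n : s 0 0 = n;
  reads_m : s 0 1 = m;
  reads_r : s 0 2 = r;
  reads_sr : forall a, s 1 a = sr a;
  reads_tg : forall a, s 2 a = tg a;
  reads_co : forall a, s 3 a = co a
}.

Lemma reads_frame s s' : (forall i, i < 4 -> s' i = s i) ->
  reads s -> reads s'.
Proof. by move=> h [*]; split=> *; rewrite h. Qed.

(** The machine cannot multiply, so the row starts of the table in array 8 are tabulated by repeated
    addition. *)
Lemma offsets_spec s : reads s -> s 7 0 = 0 ->
  forall b, b < m -> den offsets s 7 b = b * n.
Proof.
move=> hr s0.
suff H : forall b, b <= m -> den offsets s 7 b = b * n
  by move=> b /ltnW; apply: H.
apply: (@for_ind (fun k u => forall b, b <= k -> u 7 b = b * n) m) => //.
- exact: reads_m.
- by case.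
move=> k u km fr uk IH b hb; rewrite updateE /= denE updateE /= uk addn1.
case: eqP => [->|hb']; last by apply: IH; lia.
by rewrite IH // (fr 0) // reads_n //; lia.
Qed.

(* y reaches r by at most k arcs of the color of b. *)
Fixpoint reach b k y : Prop :=
  if k is k'.+1 then
    reach b k' y \/
    exists a, [/\ a < m, co a = co b, sr a = y & reach b k' (tg a)]
  else y = r.

Definition covers (f : nat -> nat) y := y = r \/ f y != 0.

(** The new vertex gets a rank above all others. No earlier tree arc enters it, as it was neither
    [r] nor in the tree, so the old ranks still decrease. *)
Lemma row_ok_relax (f f' : nat -> nat) a b :
    row_ok n m r sr tg co f b -> a < m -> co a = co b -> sr a != r ->
    f (sr a) = 0 -> covers f (tg a) ->
    (forall y, y < n -> f' y = if y == sr a then a.+1 else f y) ->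
  row_ok n m r sr tg co f' b.
Proof.
move=> [rho hrho] am cab sar fsa fta f'E.
exists (fun y => if y == sr a then (\max_(z < n) rho z).+1 else rho y) => y yn.
have grow z : z < n -> f z != 0 -> f' z != 0.
  by move=> zn fz; rewrite f'E //; case: ifP.
rewrite f'E //; have [->|ys fy] := eqVneq y (sr a); first move=> _ /=.
  split=> //=; case: fta => [e|ft]; [by left | right].
  have tn := tg_lt am.
  split; first exact: grow.
  case: ifP => [/eqP e|_]; first by rewrite e fsa in ft.
  by rewrite ltnS (leq_bigmax (Ordinal tn)).
have [h1 h2 h3 h4 h5] := hrho y yn fy; split=> //=.
case: h5 => [e|[ft lt]]; [by left | right].
have tn := tg_lt h1; split; first exact: grow.
by case: ifP => [/eqP e|//]; rewrite e fsa in ft.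
Qed.

Local Notation row s b := (fun y => s 8 (b * n + y)).

Lemma relax_spec s a b : reads s -> s 7 b = b * n -> s 20 0 = b -> s 23 0 = a ->
    a < m -> b < m -> row_ok n m r sr tg co (row s b) b ->
  let s' := den relax s in
  [/\ row_ok n m r sr tg co (row s' b) b,
      forall y, y < n -> s 8 (b * n + y) != 0 -> s' 8 (b * n + y) != 0,
      co a = co b -> covers (row s b) (tg a) -> covers (row s' b) (sr a)
    & forall i, (i < b * n) || (b.+1 * n <= i) -> s' 8 i = s 8 i].
Proof.
move=> hr s7 s20 s23 am bm rok.
pose s1 := update s 8 (b * n + sr a) a.+1.
have -> : den relax s = if [&& co a == co b, s 8 (b * n + sr a) == 0, sr a != r
    & (s 8 (b * n + tg a) != 0) || (tg a == r)] then s1 else s.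
  rewrite /relax !denE !neq_exprE /= s20 s23 s7 (reads_r hr) !(reads_sr hr).
  rewrite (reads_tg hr) !(reads_co hr).
  case: eqP => //= _; case: eqP => //= _; case: eqP => //= _.
  have [->|tr] := eqVneq (tg a) r;
    first by rewrite orbT subnn -[1 - _]/1 !addn1.
  rewrite orbF addn1; congr (if _ then _ else _).
  by apply/idP/idP; lia.
have san := sr_lt am.
set hyp := [&& _, _, _ & _]; have [|hc] := boolP hyp.
  case/and4P=> /eqP cab /eqP fsa sar fta /=.
  split.
  - apply: (row_ok_relax rok am cab sar fsa).
      by case/orP: fta => [?|/eqP ?]; [right | left].
    by move=> y yn; rewrite /s1 updateE eqxx eqn_add2l.
  - by move=> y yn h; rewrite /s1 updateE eqxx; case: ifP.
  - by move=> _ _; right; rewrite /s1 updateE !eqxx.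
  move=> i hi; rewrite /s1 updateE eqxx; case: eqP => // e.
  by move: hi; rewrite e mulSn; lia.
split=> // /eqP cab fta; move: hc; rewrite /hyp cab /=.
have -> : (s 8 (b * n + tg a) != 0) || (tg a == r).
  by case: fta => [->|->]; rewrite ?eqxx ?orbT.
rewrite andbT; case: eqP => [_|/eqP ? _]; last by right.
by rewrite negbK => /eqP; left.
Qed.

(** Rows only grow, so wherever an arc comes in the pass, a target within [k] arcs of [r] is already
    covered when the arc is relaxed. *)
Lemma pass_spec s b k : reads s -> s 7 b = b * n -> s 20 0 = b -> b < m ->
    row_ok n m r sr tg co (row s b) b ->
    (forall y, y < n -> reach b k y -> covers (row s b) y) ->
  let s' := den (For 23 1 relax) s in
  [/\ row_ok n m r sr tg co (row s' b) b,
      forall y, y < n -> reach b k.+1 y -> covers (row s' b) y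
    & forall i, (i < b * n) || (b.+1 * n <= i) -> s' 8 i = s 8 i].
Proof.
move=> hr s7 s20 bm rok hk.
pose I a u := [/\ row_ok n m r sr tg co (row u b) b,
  forall y, y < n -> reach b k y -> covers (row u b) y,
  forall a', a' < a -> co a' = co b -> reach b k (tg a') ->
    covers (row u b) (sr a')
  & forall i, (i < b * n) || (b.+1 * n <= i) -> u 8 i = s 8 i].
suff [h1 h2 h3 h4] : I m (den (For 23 1 relax) s).
  split=> // y yn [|[a [am ca sa ra]]]; first exact: h2.
  by rewrite -sa; apply: h3.
apply: for_ind => //; first exact: reads_m.
move=> a u am fr ua [h1 h2 h3 h4].
have hu : reads u by apply: reads_frame hr => -[|[|[|[|]]]] // _; apply: fr.
have [||g1 g2 g3 g4] := relax_spec hu _ _ ua am bm h1;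
  [by rewrite fr|by rewrite fr|].
have cov y : y < n -> covers (row u b) y -> covers (row (den relax u) b) y.
  by move=> yn [?|?]; [left | right; apply: g2].
split=> //.
- by move=> y yn /(h2 y yn); apply: cov.
- move=> a'; rewrite ltnS leq_eqVlt => /predU1P[->|la] ca ra.
    by apply: g3 => //; apply: h2 => //; apply: tg_lt.
  by apply: cov; [apply: sr_lt; lia | apply: h3].
by move=> i hi; rewrite -h4 // -g4.
Qed.

Lemma reach_color_spec s b : reads s -> s 7 b = b * n -> s 20 0 = b -> b < m ->
    (forall y, y < n -> s 8 (b * n + y) = 0) ->
  let s' := den reach_color s in
  [/\ row_ok n m r sr tg co (row s' b) b,
      forall y, y < n -> reach b n y -> covers (row s' b) y
    & forall i, (i < b * n) || (b.+1 * n <= i) -> s' 8 i = s 8 i].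
Proof.
move=> hr s7 s20 bm z.
pose I k u := [/\ row_ok n m r sr tg co (row u b) b,
  forall y, y < n -> reach b k y -> covers (row u b) y
  & forall i, (i < b * n) || (b.+1 * n <= i) -> u 8 i = s 8 i].
apply: (@for_ind I) => //; first exact: reads_n.
  split=> //; last by left.
  by exists id => y yn /=; rewrite updateE /= z.
move=> k u kn fr uk [h1 h2 h3].
have hu : reads u by apply: reads_frame hr => -[|[|[|[|]]]] // _; apply: fr.
have [||g1 g2 g3] := pass_spec hu _ _ bm h1 h2; [by rewrite fr|by rewrite fr|].
by split=> // i hi; rewrite -h3 // -g3.
Qed.

Lemma reach_all_spec s : reads s -> (forall b, b < m -> s 7 b = b * n) ->
    (forall i, s 8 i = 0) ->
  let s' := den reach_all s in
  forall b, b < m -> row_ok n m r sr tg co (row s' b) b /\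
    forall y, y < n -> reach b n y -> covers (row s' b) y.
Proof.
move=> hr s7 z.
(* The rows not yet treated must still be zero, since each in-tree is grown from the empty one. *)
pose I k u := (forall i, k * n <= i -> u 8 i = 0) /\
  forall b, b < k -> row_ok n m r sr tg co (row u b) b /\
    forall y, y < n -> reach b n y -> covers (row u b) y.
suff [] : I m (den reach_all s) by [].
apply: for_ind => //; first exact: reads_m.
  by split=> // i _; apply: z.
move=> b u bm fr ub [z' h].
have hu : reads u by apply: reads_frame hr => -[|[|[|[|]]]] // _; apply: fr.
have [||g1 g2 g3] := reach_color_spec hu _ ub bm;
  [by rewrite fr // s7|by move=> y yn; rewrite z' //; lia|].
split=> [i hi|b']; first by rewrite updateE /= g3 ?hi ?orbT // z' //; lia.
rewrite ltnS leq_eqVlt => /predU1P[->|lb] //.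
have same y : y < n -> den reach_color u 8 (b' * n + y) = u 8 (b' * n + y).
  by move=> yn; rewrite g3 //; nia.
have [[rho hrho] h2] := h b' lb; split.
  exists rho => y yn; rewrite !updateE /= same // => fy.
  have [k1 k2 k3 k4 k5] := hrho y yn fy; split=> //.
  by rewrite updateE /= same //; apply: tg_lt.
by move=> y yn ry; rewrite /covers updateE /= same //; apply: h2.
Qed.

End ReachPrograms.

(** * Programs for the tokens and for a round of elimination *)

Definition init_color :=
  For 20 1 (Cond (next_expr vb vv) (Do 10 vv (succ_expr vb)) Nop).

(** Only colors chosen by some terminal are activated, which keeps their number at most that of the
    terminals. *)
Definition init_token :=
  Then init_color
  (Then (Do 9 (pred_expr (Read 10 vv)) (Const 1))
  (Then (Do 11 vv vv) (Do 12 vv (Const 1)))).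

Definition init := For 22 0 (Cond (Read 4 vv) init_token Nop).

Definition clear_loads := For 20 1 (Do 13 (succ_expr vb) (Const 0)).

(** Position 0 receives the weights of tokens without a color. It is not cleared, and no choice
    depends on it. *)
Definition add_loads :=
  For 22 0 (Do 13 (Read 10 vv) (Plus (Read 13 (Read 10 vv)) (Read 12 vv))).

(** The first summand of the inner test makes it succeed as long as there is no candidate. *)
Definition choose_color :=
  Then (Do 14 (Const 0) (Const 0))
  (For 20 1 (Cond (Read 9 vb)
    (Cond (Plus (Minus (Const 1) best)
             (Minus (Read 13 best) (Read 13 (succ_expr vb))))
       (Do 14 (Const 0) (succ_expr vb)) Nop) Nop)).

Definition find_live :=
  For 20 1 (Cond (Read 9 vb)
    (Cond (next_expr vb vv) (Do 15 vv (succ_expr vb)) Nop) Nop).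

Definition find_all_live := For 22 0 (Then (Do 15 vv (Const 0)) find_live).

Definition settle :=
  For 22 0 (Cond (next_expr (pred_expr best) vv)
    (Cond (Read 15 vv) Nop (Do 5 vv (next_expr (pred_expr best) vv))) Nop).

Definition walk :=
  For 21 0 (Cond (Read 15 (Read 11 vv)) Nop
    (Cond (neq_expr (Read 11 vv) root_expr)
      (Do 11 vv (Read 2 (pred_expr (Read 5 (Read 11 vv))))) Nop)).

Definition switch_color :=
  Then (Cond (Read 15 (Read 11 vv))
          (Do 12 vv (Plus (Read 12 vv) (Read 12 vv))) Nop)
       (Do 10 vv (Read 15 (Read 11 vv))).

Definition move_tokens :=
  For 22 0 (Cond (neq_expr (Read 10 vv) best) Nop (Then walk switch_color)).

(** The order matters: liveness is computed after the deactivation, and tokens walk along arcs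
    settled just before. *)
Definition remove_color :=
  Then (Do 9 (pred_expr best) (Const 0))
  (Then find_all_live (Then settle move_tokens)).

Definition round :=
  Then (Then clear_loads add_loads)
  (Then choose_color (Cond best remove_color Nop)).

(** The array of leaving arcs serves as vector of vertices once [r], which has no leaving arc, is
    marked. *)
Definition finish :=
  Then (For 22 0 (Cond (Read 5 vv)
         (Do 6 (pred_expr (Read 5 vv)) (Const 1)) Nop))
       (Do 5 root_expr (Const 1)).

(** The additive form avoids truncated subtraction. *)
Lemma sum_update (N : nat) (f f' : nat -> nat) i : i < N ->
  (forall j, j != i -> f' j = f j) ->
  \sum_(j < N) f' j + f i = \sum_(j < N) f j + f' i.
Proof.
move=> iN h; rewrite (bigD1 (Ordinal iN)) //= [in RHS](bigD1 (Ordinal iN)) //=.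
rewrite (eq_bigr (fun j : 'I_N => f j)); first lia.
by move=> j ji; apply: h; apply: contraNneq ji => e; apply/eqP/val_inj.
Qed.

(** * Correctness of the initialization and of the rounds *)

Section Rounds.
Variables (n m r : nat) (sr tg co : nat -> nat).
Hypothesis r_lt : r < n.
Hypothesis sr_lt : forall a, a < m -> sr a < n.
Hypothesis tg_lt : forall a, a < m -> tg a < n.
Variable N : nat -> nat.
Let nx b y := N (b * n + y).
Hypothesis nx_ok : forall b, b < m -> row_ok n m r sr tg co (nx b) b.

(** This is what all rounds preserve: the graph, the row starts, and the table of in-trees, frozen
    as [N]. *)
Record tables (s : store) : Prop := Tables {
  tables_reads : reads n m r sr tg co s;
  tables_off : forall b, b < m -> s 7 b = b * n;
  tables_nx : forall i, s 8 i = N i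
}.

Lemma tables_frame s s' : s' 0 = s 0 -> s' 1 = s 1 -> s' 2 = s 2 ->
  s' 3 = s 3 -> s' 7 = s 7 -> s' 8 = s 8 -> tables s -> tables s'.
Proof.
move=> e0 e1 e2 e3 e7 e8 [h1 h2 h3]; split.
- by apply: reads_frame h1 => -[|[|[|[|]]]].
- by move=> b bm; rewrite e7 h2.
by move=> i; rewrite e8.
Qed.

Lemma next_exprE s e f : tables s -> eval s e < m ->
  eval s (next_expr e f) = nx (eval s e) (eval s f).
Proof. by move=> [_ h2 h3] he; rewrite /= h2 // h3. Qed.

Lemma init_color_spec s v : tables s -> s 22 0 = v -> s 10 v = 0 ->
  let s' := den init_color s in
  (forall y, y != v -> s' 10 y = s 10 y) /\
  if s' 10 v is b.+1 then b < m /\ nx b v != 0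
  else forall b, b < m -> nx b v = 0.
Proof.
move=> ts s22 s10.
pose I k u := (forall y, y != v -> u 10 y = s 10 y) /\
  if u 10 v is b.+1 then b < m /\ nx b v != 0
  else forall b, b < k -> nx b v = 0.
apply: (@for_ind I) => //; first exact: (reads_m (tables_reads ts)).
  by split=> //; rewrite updateE /= s10.
move=> k u km fr uk [h1 h2].
have tu : tables u by apply: tables_frame ts; rewrite fr.
rewrite /I denE (next_exprE _ tu) /= ?uk // fr // s22.
have [nk|nk] /= := boolP (nx k v != 0).
  rewrite denE /= fr // s22 uk addn1; split; last by rewrite !updateE /= eqxx.
  by move=> y yv; rewrite !updateE /= (negPf yv) h1.
rewrite denE; split; first exact: h1.
rewrite updateE /=; case: (u 10 v) h2 => // h2 b;
  rewrite ltnS leq_eqVlt => /predU1P[->|].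
  by apply/eqP; rewrite negbK in nk.
exact: h2.
Qed.

Local Notation elim_inv := (elim_inv n m r sr tg co nx).
Local Notation sinv k u := (elim_inv k (u 9) (u 5) (u 11) (u 10) (u 12)).

Lemma init_spec s k : tables s ->
    (forall i, s 5 i = 0) -> (forall i, s 9 i = 0) -> (forall i, s 10 i = 0) ->
    (forall i, s 12 i = 0) ->
    (forall v, v < n -> s 4 v <= 1) ->
    (forall v, v < n -> s 4 v != 0 -> exists2 b, b < m & nx b v != 0) ->
    k = \sum_(v < n) s 4 v ->
  let u := den init s in
  sinv k u /\ forall v, v < n -> u 12 v = s 4 v.
Proof.
move=> ts s5 s9 s10 s12 s4 hex kE.
(* The third clause charges every active color to a terminal that chose it. *)
pose I i u := [/\ forall b, u 9 b <= 1,
  forall v, u 12 v = if v < i then s 4 v else 0,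
  \sum_(b < m) u 9 b <= \sum_(v < n) u 12 v,
  forall v, v < n -> u 12 v != 0 -> exists b,
    [/\ b < m, u 10 v = b.+1, u 9 b != 0, nx b v != 0 & u 11 v = v]
  & forall v, u 12 v = 0 -> u 10 v = 0].
suff [h1 h2 h3 h4 h5] : I n (den init s).
  have w4 v : v < n -> den init s 12 v = s 4 v by move=> vn; rewrite h2 vn.
  have o0 y : den init s 5 y = 0 by rewrite den_frame.
  split=> //; split=> //.
  - by move=> y _; rewrite o0.
  - by move=> y _; rewrite o0.
  - move=> v vn wv; have [b [bm cE ab nb pE]] := h4 v vn wv.
    exists [::]; rewrite pE cE; split=> //=; split=> //.
    by rewrite /seq_switches /= expn0 lt0n.
  - by move=> v _; apply: h5.
  have -> : \sum_(v < n) den init s 12 v = k.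
    by rewrite kE; apply: eq_bigr => v _; apply: w4.
  have lek : \sum_(b < m) den init s 9 b <= k.
    by apply: leq_trans h3 _; rewrite kE leq_sum // => v _; rewrite w4.
  (* The case [k = 0] is separate because the maximum with 1 exceeds [k] there; both sides then
     vanish. *)
  by case: k lek {kE} => // k; move: (\sum_(b < m) _) => J lek;
    rewrite leq_mul2l ltnS geq_max lek.
apply: for_ind => //; first exact: (reads_n (tables_reads ts)).
  split=> [b|v||v _|v] /=; rewrite ?updateE /= ?s9 ?s10 ?s12 //.
  by rewrite big1 // => b _; rewrite updateE /= s9.
move=> i u im fr ui [h1 h2 h3 h4 h5].
have tu : tables u by apply: tables_frame ts; rewrite fr.
have w0 : u 12 i = 0 by rewrite h2 ltnn.
rewrite denE [eval _ _]/= ui fr //.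
have [v4|v4] := boolP (s 4 i != 0); last first.
  rewrite denE; split=> //.
  move=> v; rewrite updateE /= h2 [v < i.+1]ltnS [v <= i]leq_eqVlt.
  by have [->|] := eqVneq v i => //=; rewrite ltnn; apply/esym/eqP;
    rewrite negbK in v4.
have v41 : s 4 i = 1 by move: (s4 i im) v4; case: (s 4 i) => [|[]].
have [g1] := init_color_spec tu ui (h5 i w0).
rewrite /init_token !denE.
set u1 := den init_color u in g1 *.
have u1i : u1 22 0 = i by rewrite /u1 den_frame.
have u19 : u1 9 = u 9 by rewrite /u1 den_frame.
have u111 : u1 11 = u 11 by rewrite /u1 den_frame.
have u112 : u1 12 = u 12 by rewrite /u1 den_frame.
have [b0 b0m nb0] := hex i im v4.
case u10 : (u1 10 i) => [|b] g2; first by rewrite g2 // in nb0.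
case: g2 => bm nb.
rewrite /= updateE /= updateE /= u1i u10 subn1 /=.
rewrite [update u1 9 b 1 22 0]updateE /= u1i.
split.
- by move=> j; rewrite !updateE /= u19; case: ifP.
- move=> v; rewrite !updateE /= u112 h2 [v < i.+1]ltnS [v <= i]leq_eqVlt.
  by case: (eqVneq v i) => [->|] //=; rewrite v41.
- rewrite (eq_bigr (fun j : 'I_m => if (j : nat) == b then 1 else u 9 j));
    last first.
    by move=> j _; rewrite !updateE /= u19.
  rewrite [X in _ <= X](eq_bigr (fun j : 'I_n =>
    if (j : nat) == i then 1 else u 12 j)); last first.
    by move=> j _; rewrite !updateE /= u112.
  (* The weight grows by exactly 1, the number of active colors by 1 or, if [b] was active already,
     not at all. *)
  have e1 := @sum_update m (u 9) (fun j => if j == b then 1 else u 9 j) b bm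
    (fun j (jb : j != b) => ifN_eq _ _ jb).
  have e2 := @sum_update n (u 12) (fun j => if j == i then 1 else u 12 j) i im
    (fun j (ji : j != i) => ifN_eq _ _ ji).
  rewrite eqxx in e1; rewrite eqxx w0 addn0 in e2.
  rewrite e2 -(leq_add2r (u 9 b)) e1 addnAC leq_add2r.
  exact: leq_trans h3 (leq_addr _ _).
- move=> v vn; rewrite !updateE /= u112 u111; case: (eqVneq v i) => [->|vi] wv.
    by exists b; rewrite ?updateE /= ?eqxx u10.
  have [b' [k1 k2 k3 k4 k5]] := h4 v vn wv.
  exists b'; split=> //; first by rewrite g1.
  by rewrite ?updateE /= u19; case: ifP.
move=> v; rewrite !updateE /= u112; case: (eqVneq v i) => //= vi wv.
by rewrite g1 // h5.
Qed.

Lemma loads_spec u : tables u -> forall b, b < m ->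
  den (Then clear_loads add_loads) u 13 b.+1 = load n (u 10) (u 12) b.+1.
Proof.
move=> tu b bm; rewrite denT.
have z : den clear_loads u 13 b.+1 = 0.
  suff H : forall b', b' < m -> den clear_loads u 13 b'.+1 = 0 by apply: H.
  apply: (@for_ind (fun k u => forall b', b' < k -> u 13 b'.+1 = 0)) => //.
    exact: (reads_m (tables_reads tu)).
  move=> k u' km fr uk IH b' hb; rewrite denE !updateE /= uk addn1.
  by case: eqP => // hb'; apply: IH; lia.
have tc : tables (den clear_loads u) by apply: tables_frame tu;
  rewrite den_frame.
have e10 : den clear_loads u 10 = u 10 by rewrite den_frame.
have e12 : den clear_loads u 12 = u 12 by rewrite den_frame.
rewrite /load big_mkcond -e10 -e12.
move: (den clear_loads u) z tc => s z ts {e10 e12}.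
apply: (@for_ind (fun k u => u 13 b.+1 =
  \sum_(v < k) (if s 10 v == b.+1 then s 12 v else 0))) => //.
- exact: (reads_n (tables_reads ts)).
- by rewrite big_ord0 updateE /= z.
move=> k u' kn fr uk IH.
rewrite big_ord_recr /= -IH denE !updateE /= uk (fr 10) // (fr 12) // eq_sym.
by case: eqP => [->|]; rewrite ?addn0.
Qed.

Lemma choose_spec u : tables u -> let u' := den choose_color u in
  if u' 14 0 is c.+1 then
    [/\ c < m, u 9 c != 0
      & forall b, b < m -> u 9 b != 0 -> u 13 c.+1 <= u 13 b.+1]
  else forall b, b < m -> u 9 b = 0.
Proof.
move=> tu; rewrite /choose_color denT denD.
set s := update _ _ _ _.
have ts : tables s by apply: tables_frame tu.
have -> : u 9 = s 9 by [].
have -> : u 13 = s 13 by [].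
have s14 : s 14 0 = 0 by [].
apply: (@for_ind (fun k u' => if u' 14 0 is c.+1 then
    [/\ c < m, s 9 c != 0
      & forall b, b < k -> s 9 b != 0 -> s 13 c.+1 <= s 13 b.+1]
  else forall b, b < k -> s 9 b = 0)) => //.
- exact: (reads_m (tables_reads ts)).
move=> k u' km fr uk IH; rewrite !denE [eval _ (Read 9 _)]/= uk fr //.
have [ak|ak] := boolP (s 9 k != 0); last first.
  rewrite updateE /=; case: (u' 14 0) IH => [|c] IH.
    move=> b; rewrite ltnS leq_eqVlt => /predU1P[->|]; last exact: IH.
    by apply/eqP; rewrite negbK in ak.
  case: IH => cm ac IH; split=> // b; rewrite ltnS leq_eqVlt => /predU1P[->|].
    by rewrite (negPf ak).
  exact: IH.
rewrite [eval _ _]/= uk (fr 13) // addn1.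
case c14: (u' 14 0) IH => [|c] IH.
  rewrite updateE /= updateE /= uk addn1; split=> // b.
  rewrite ltnS leq_eqVlt => /predU1P[->|] // lb; by rewrite (IH b lb).
case: IH => cm ac IH; case: ifP => h.
  rewrite updateE /= updateE /= uk addn1; split=> // b.
  rewrite ltnS leq_eqVlt => /predU1P[->|] // lb ab.
  by apply: leq_trans (IH b lb ab); move: h; lia.
rewrite updateE /= c14; split=> // b.
by rewrite ltnS leq_eqVlt => /predU1P[-> _|]; [move: h; lia | apply: IH].
Qed.

Lemma find_live_spec s y : tables s -> s 22 0 = y -> s 15 y = 0 ->
  let s' := den find_live s in
  (forall z, z != y -> s' 15 z = s 15 z) /\
  if s' 15 y is b.+1 then [/\ b < m, s 9 b != 0 & nx b y != 0]
  else ~ live m nx (s 9) y.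
Proof.
move=> ts s22 s15.
pose I k u := (forall z, z != y -> u 15 z = s 15 z) /\
  if u 15 y is b.+1 then [/\ b < m, s 9 b != 0 & nx b y != 0]
  else forall b, b < k -> s 9 b != 0 -> nx b y = 0.
suff [h1 h2] : I m (den find_live s).
  split=> //; case: (den find_live s 15 y) h2 => // h2 [b [bm ab nb]].
  by rewrite h2 in nb.
apply: (@for_ind I) => //; first exact: (reads_m (tables_reads ts)).
  by split=> //; rewrite updateE /= s15.
move=> k u km fr uk [h1 h2].
have tu : tables u by apply: tables_frame ts; rewrite fr.
rewrite /I !denE (next_exprE _ tu) /= ?uk // !fr // s22.
have [/andP[ak nk]|h] := boolP ((s 9 k != 0) && (nx k y != 0)).
  rewrite ak nk addn1; split; last by rewrite !updateE /= eqxx.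
  by move=> z zy; rewrite !updateE /= (negPf zy) h1.
have -> : (if s 9 k != 0 then
    if nx k y != 0 then update u 15 y (k + 1) else u else u) = u.
  by move: h; case: (s 9 k != 0) => //=; case: (nx k y != 0).
split; first exact: h1.
rewrite updateE /=; case: (u 15 y) h2 => // h2 b;
  rewrite ltnS leq_eqVlt => /predU1P[->|].
  by move=> ak; apply/eqP; rewrite ak /= negbK in h.
exact: h2.
Qed.

Lemma find_all_live_spec s : tables s -> forall y, y < n ->
  if den find_all_live s 15 y is b.+1 then [/\ b < m, s 9 b != 0 & nx b y != 0]
  else ~ live m nx (s 9) y.
Proof.
move=> ts.
apply: (@for_ind (fun k u => forall y, y < k ->
  if u 15 y is b.+1 then [/\ b < m, s 9 b != 0 & nx b y != 0]
  else ~ live m nx (s 9) y)) => //; first exact: (reads_n (tables_reads ts)).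
move=> k u kn fr uk IH y.
rewrite denT denD /= uk.
set u1 := update u 15 k 0.
have tu : tables u1 by apply: tables_frame ts; rewrite /u1 update_frame ?fr.
have [||h1 h2] := @find_live_spec u1 k tu;
  [exact: uk | by rewrite /u1 updateE /= eqxx |].
have e9 : u1 9 = s 9 by rewrite /u1 update_frame ?fr.
rewrite e9 in h2.
rewrite ltnS leq_eqVlt updateE /=; have [->|yk] := eqVneq y k => //= lyk.
by rewrite h1 // /u1 updateE /= (negPf yk); apply: IH.
Qed.

Lemma settle_spec s c : tables s -> s 14 0 = c.+1 -> c < m -> forall y, y < n ->
  den settle s 5 y = if (nx c y != 0) && (s 15 y == 0) then nx c y else s 5 y.
Proof.
move=> ts s14 cm y yn.
pose I k (u : store) := u 5 y =
  if [&& y < k, nx c y != 0 & s 15 y == 0] then nx c y else s 5 y.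
suff : I n (den settle s) by rewrite /I yn.
apply: (@for_ind I) => //; first exact: (reads_n (tables_reads ts)).
move=> k u kn fr uk IH.
have tu : tables u by apply: tables_frame ts; rewrite fr.
have be : eval u (pred_expr best) = c by rewrite /= fr // s14 subn1.
rewrite !denE !(next_exprE _ tu) be // [eval u vv]/= uk.
rewrite [eval u _]/= uk fr // /I updateE /= ltnS leq_eqVlt.
move: IH; rewrite /I; have [->|yk] /= := eqVneq y k => [|<-].
  rewrite ltnn /= => IH.
  by case: ifP => //= nk; case: eqP => //= h; rewrite updateE /= eqxx.
by do 2 (case: ifP => //= _); rewrite updateE /= (negPf yk).
Qed.

Lemma walk_spec s v : tables s -> s 22 0 = v ->
  (forall y, y != v -> den walk s 11 y = s 11 y) /\
  den walk s 11 v = iter n (walk_step r tg (s 15) (s 5)) (s 11 v).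
Proof.
move=> ts s22.
apply: (@for_ind (fun k u => (forall y, y != v -> u 11 y = s 11 y) /\
  u 11 v = iter k (walk_step r tg (s 15) (s 5)) (s 11 v))) => //.
- exact: (reads_n (tables_reads ts)).
move=> k u kn fr uk [h1 h2]; rewrite iterS -h2 /walk_step.
have hu : reads n m r sr tg co u.
  by apply: reads_frame (tables_reads ts) => -[|[|[|[|]]]] // _; rewrite fr.
rewrite !denE neq_exprE /= (reads_tg hu) (reads_r hu) subn1.
rewrite (fr 22) // (fr 15) // (fr 5) // s22.
case: ifP => _; first by split=> //.
case: (u 11 v == r); split=> //= [y yv|]; rewrite !updateE /= ?eqxx //.
by rewrite (negPf yv) h1.
Qed.

Lemma switch_color_spec s v y : s 22 0 = v -> let s' := den switch_color s in
  [/\ s' 11 y = s 11 y, s' 10 y = if y == v then s 15 (s 11 v) else s 10 y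
    & s' 12 y = if (y == v) && (s 15 (s 11 v) != 0) then s 12 v + s 12 v
                else s 12 y].
Proof.
move=> s22; rewrite /switch_color !denE /= s22.
by case: ifP => h; rewrite !updateE /= ?s22 ?andbT ?andbF; split.
Qed.

Lemma move_tokens_spec s c : tables s -> s 14 0 = c.+1 ->
  let u := den move_tokens s in forall v, v < n ->
  if s 10 v == c.+1 then
    [/\ u 11 v = iter n (walk_step r tg (s 15) (s 5)) (s 11 v),
      u 10 v = s 15 (u 11 v)
    & u 12 v = if s 15 (u 11 v) != 0 then s 12 v + s 12 v else s 12 v]
  else [/\ u 11 v = s 11 v, u 10 v = s 10 v & u 12 v = s 12 v].
Proof.
move=> ts s14 /= v vn.
pose P (u : store) := if s 10 v == c.+1 then
    [/\ u 11 v = iter n (walk_step r tg (s 15) (s 5)) (s 11 v),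
      u 10 v = s 15 (u 11 v)
    & u 12 v = if s 15 (u 11 v) != 0 then s 12 v + s 12 v else s 12 v]
  else [/\ u 11 v = s 11 v, u 10 v = s 10 v & u 12 v = s 12 v].
pose I k u := if v < k then P u
  else [/\ u 11 v = s 11 v, u 10 v = s 10 v & u 12 v = s 12 v].
suff : I n (den move_tokens s) by rewrite /I vn.
apply: (@for_ind I) => //; first exact: (reads_n (tables_reads ts)).
move=> k u kn fr uk IH.
have tu : tables u by apply: tables_frame ts; rewrite fr.
rewrite denC denT denN neq_exprE [eval u _]/= [eval u best]/= uk (fr 14) // s14.
have [w1 w2] := walk_spec tu uk.
set u1 := den walk u in w1 w2 *.
have u1k : u1 22 0 = k by rewrite /u1 den_frame.
have e15 : u1 15 = s 15 by rewrite /u1 den_frame // fr.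
have e10 : u1 10 = u 10 by rewrite /u1 den_frame.
have e12 : u1 12 = u 12 by rewrite /u1 den_frame.
rewrite (fr 15) // (fr 5) // in w2.
have [vk|vk] := eqVneq v k; last first.
  have IH' : I k.+1 u.
    move: IH; rewrite /I ltnS [v <= k]leq_eqVlt (negPf vk) //.
  have [//|hk] := boolP (u 10 k != c.+1).
  have [q1 q2 q3] := switch_color_spec v u1k.
  rewrite (negPf vk) /= in q2 q3.
  move: IH'; rewrite /I /P !updateE /=.
  by rewrite q1 q2 q3 w1 // e10 e12.
move: IH; rewrite /I -vk ltnn ltnSn /P => -[p1 p2 p3].
rewrite p2; case: eqP => [e|//] /=.
rewrite -vk in u1k w2; have [q1 q2 q3] := switch_color_spec v u1k.
rewrite eqxx /= in q2 q3.
by rewrite !updateE /= q1 q2 q3 w2 e15 e12 p1 p3.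
Qed.

(** A round without active colors leaves the invariant's arrays alone; the predecessor, with value 0
    at 0, covers this case too. *)
Lemma round_spec k u : tables u -> sinv k u -> let u' := den round u in
  [/\ sinv k u', \sum_(b < m) u' 9 b = (\sum_(b < m) u 9 b).-1
    & forall v, v < n -> u 12 v != 0 -> u' 12 v != 0].
Proof.
move=> tu inv; rewrite /round 2!denT.
have ld := loads_spec tu.
set u1 := den (Then clear_loads add_loads) u in ld *.
have [f5 f9 f10] : [/\ u1 5 = u 5, u1 9 = u 9 & u1 10 = u 10].
  by split; rewrite /u1 den_frame.
have [f11 f12] : u1 11 = u 11 /\ u1 12 = u 12 by split; rewrite /u1 den_frame.
have {}tu : tables u1 by apply: tables_frame tu; rewrite /u1 den_frame.
have {}ld b : b < m -> u1 13 b.+1 = load n (u1 10) (u1 12) b.+1.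
  by rewrite f10 f12; apply: ld.
rewrite -f5 -f9 -f10 -f11 -f12 in inv *.
(* Computing the loads touches no array of the invariant, so the new store takes the place of [u];
   the same happens after the choice of a color. *)
move: u1 tu ld inv {f5 f9 f10 f11 f12} => {}u tu ld inv.
have := choose_spec tu.
set u1 := den choose_color u.
have [f5 f9 f10] : [/\ u1 5 = u 5, u1 9 = u 9 & u1 10 = u 10].
  by split; rewrite /u1 den_frame.
have [f11 f12] : u1 11 = u 11 /\ u1 12 = u 12 by split; rewrite /u1 den_frame.
have {}tu : tables u1 by apply: tables_frame tu; rewrite /u1 den_frame.
have f13 : u1 13 = u 13 by rewrite /u1 den_frame.
rewrite -f13 -f10 -f12 in ld; rewrite -f5 -f9 -f10 -f11 -f12 in inv *.
rewrite -f13.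
move: u1 tu ld inv {f5 f9 f10 f11 f12 f13} => {}u tu ld inv.
rewrite denC [eval _ _]/=.
move=> ch; case u14: (u 14 0) => [|c]; rewrite /= u14 in ch.
  by rewrite denN /=; split=> //; rewrite big1 // => b _; apply: ch.
case: ch => cm ac mn; rewrite [_ != 0]/=.
rewrite /remove_color denT denD 2!denT /= u14 subn1 /=.
set u1 := update u 9 c 0.
have t1 : tables u1 by apply: tables_frame tu.
have lv := find_all_live_spec t1.
set u2 := den find_all_live u1 in lv *.
have t2 : tables u2 by apply: tables_frame t1; rewrite /u2 den_frame.
have u2_14 : u2 14 0 = c.+1 by rewrite /u2 den_frame.
have st := settle_spec t2 u2_14 cm.
set u3 := den settle u2 in st *.
have t3 : tables u3 by apply: tables_frame t2; rewrite /u3 den_frame.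
have u3_14 : u3 14 0 = c.+1 by rewrite /u3 den_frame.
have mv := move_tokens_spec t3 u3_14.
set u4 := den move_tokens u3 in mv *.
have g9 : u4 9 = u1 9
  by rewrite /u4 den_frame // /u3 den_frame // /u2 den_frame.
have g5 : u4 5 = u3 5 by rewrite /u4 den_frame.
have h5 : u2 5 = u 5 by rewrite /u2 den_frame.
have h15 : u3 15 = u2 15 by rewrite /u3 den_frame.
have h10 : u3 10 = u 10 by rewrite /u3 den_frame // /u2 den_frame.
have h11 : u3 11 = u 11 by rewrite /u3 den_frame // /u2 den_frame.
have h12 : u3 12 = u 12 by rewrite /u3 den_frame // /u2 den_frame.
rewrite h5 in st; rewrite h15 h10 h11 h12 in mv.
have act'E b : b < m -> u4 9 b = if b == c then 0 else u 9 b by rewrite g9.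
rewrite g5.
have inv' : elim_inv k (u4 9) (u3 5) (u4 11) (u4 10) (u4 12).
  apply: (elim_step (lv := u2 15) r_lt sr_lt tg_lt nx_ok inv cm ac _ act'E)
    => //.
  - by move=> b bm ab; rewrite -!ld //; apply: mn.
  - by move=> y yn; rewrite g9; apply: lv.
  - by move=> v vn cv; have := mv v vn; rewrite cv eqxx.
  by move=> v vn /negPf cv; have := mv v vn; rewrite cv.
split=> //; first by rewrite (sum_act inv cm ac act'E).
move=> v vn wv; have := mv v vn; case: ifP => _ [_ _ ->] //.
by case: ifP => // _; rewrite addn_eq0 negb_and wv.
Qed.

End Rounds.

(** * The whole program *)

Definition arborescence_prog :=
  Then offsets (Then reach_all (Then init (Then (For 24 1 round) finish))).

Lemma finish_spec n r u : u 0 0 = n -> u 0 2 = r -> (forall i, u 6 i = 0) ->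
  let s := den finish u in
  (forall y, s 5 y = if y == r then 1 else u 5 y) /\
  forall a, s 6 a != 0 <-> exists2 y, y < n & u 5 y != 0 /\ (u 5 y).-1 = a.
Proof.
move=> u0 ur u6; rewrite /finish denT denD /=; set s := den _ u.
have s5 : s 5 = u 5 by rewrite /s den_frame.
have s0 : s 0 = u 0 by rewrite /s den_frame.
split=> [y|a]; first by rewrite updateE /= s0 ur s5.
rewrite updateE /=.
apply: (@for_ind (fun k s => s 6 a != 0 <->
  exists2 y, y < k & u 5 y != 0 /\ (u 5 y).-1 = a)) => //.
  by rewrite updateE /= u6; split=> // -[].
move=> k v kn fr vk IH; rewrite denE [eval _ _]/= vk fr // updateE /=.
case: ifP => [uk|/negbT uk].
  rewrite denE /= vk fr // subn1 updateE /=.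
  have [->|ne] := eqVneq a (u 5 k).-1; first by split=> // _; exists k.
  rewrite IH; split=> -[y yk h]; exists y => //; first lia.
  by move: yk; rewrite ltnS leq_eqVlt => /predU1P[e|//]; case: h ne;
    rewrite e => _ ->; rewrite eqxx.
rewrite denN IH; split=> -[y yk h]; exists y => //; first lia.
by move: yk; rewrite ltnS leq_eqVlt => /predU1P[e|//]; case: h;
  rewrite e (negPf uk).
Qed.

Lemma arborescence_prog_spec n m r (sr tg co : nat -> nat) k s :
    r < n -> (forall a, a < m -> sr a < n) -> (forall a, a < m -> tg a < n) ->
    reads n m r sr tg co s -> (forall i, 4 < i -> forall j, s i j = 0) ->
    (forall v, v < n -> s 4 v <= 1) -> k = \sum_(v < n) s 4 v ->
    (forall v, v < n -> s 4 v != 0 ->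
       v != r /\ exists2 b, b < m & reach m r sr tg co b n v) ->
  let s' := den arborescence_prog s in
  exists out : nat -> nat,
    [/\ out r = 0,
        forall y, y < n -> out y != 0 -> exists p, follows m sr tg out y p r,
        forall v, v < n -> s 4 v != 0 -> exists2 p, follows m sr tg out v p r
          & 2 ^ (seq_switches (map co p)).+1 <= k * k.+1,
        forall y, y < n -> s' 5 y != 0 <-> y = r \/ out y != 0
      & forall a, a < m -> s' 6 a != 0 <-> out (sr a) = a.+1].
Proof.
move=> r_lt sr_lt tg_lt hr z s4 kE hreach.
rewrite /arborescence_prog 4!denT.
have h1 : forall b, b < m -> den offsets s 7 b = b * n.
  by apply: (offsets_spec hr); rewrite z.
set s1 := den offsets s in h1 *.
have r1 : reads n m r sr tg co s1.
  by apply: reads_frame hr => -[|[|[|[|]]]] // _; rewrite /s1 den_frame.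
have h2 := reach_all_spec sr_lt tg_lt r1 h1.
set s2 := den reach_all s1 in h2 *.
have {}h2 : forall b, b < m ->
    row_ok n m r sr tg co (fun y => s2 8 (b * n + y)) b /\
    forall y, y < n -> reach m r sr tg co b n y ->
      covers r (fun y => s2 8 (b * n + y)) y.
  by apply: h2 => i; rewrite /s1 den_frame // z.
have r2 : reads n m r sr tg co s2.
  by apply: reads_frame r1 => -[|[|[|[|]]]] // _; rewrite /s2 den_frame.
have t2 : tables n m r sr tg co (s2 8) s2.
  by split=> // b bm; rewrite /s2 den_frame ?h1.
have z2 i j : i \in [:: 5; 6; 9; 10; 12] -> s2 i j = 0.
  by rewrite !inE => /or4P[|||/orP[]] /eqP->;
    rewrite /s2 den_frame // /s1 den_frame // z.
have s24 : s2 4 = s 4 by rewrite /s2 den_frame // /s1 den_frame.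
have nx_ok b : b < m -> row_ok n m r sr tg co (fun y => s2 8 (b * n + y)) b.
  by move=> /h2[].
have [|||||v vn sv||inv3 w3] := init_spec t2 (k := k).
- by move=> i; apply: z2.
- by move=> i; apply: z2.
- by move=> i; apply: z2.
- by move=> i; apply: z2.
- by rewrite s24.
- rewrite s24 in sv; have [vr [b bm rb]] := hreach v vn sv.
  by exists b => //; case: (h2 b bm) => _ /(_ v vn rb)[e|//];
    rewrite e eqxx in vr.
- by rewrite s24.
set s3 := den init s2 in inv3 w3 *.
have t3 : tables n m r sr tg co (s2 8) s3.
  by apply: tables_frame t2; rewrite /s3 den_frame.
(* Colors are represented by arcs, so at most [m] are active at first, and [m] rounds leave none. *)
pose I i u := [/\ elim_inv n m r sr tg co (fun b y => s2 8 (b * n + y)) k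
    (u 9) (u 5) (u 11) (u 10) (u 12),
  \sum_(b < m) u 9 b <= m - i
  & forall v, v < n -> s3 12 v != 0 -> u 12 v != 0].
have [inv4 J0 w4] : I m (den (For 24 1 round) s3).
  apply: for_ind => //; first exact: (reads_m (tables_reads t3)).
    split=> //; rewrite subn0 -[X in _ <= X]card_ord -sum1_card.
    by apply: leq_sum => b _; apply: (inv_act inv3).
  move=> i u im fr ui [inv J w].
  have tu : tables n m r sr tg co (s2 8) u by apply: tables_frame t3;
    rewrite fr.
  have [g1 g2 g3] := round_spec r_lt sr_lt tg_lt nx_ok tu inv.
  split=> //; last by move=> v vn /(w v vn) /(g3 v vn).
  by rewrite (eq_bigr (fun b : 'I_m => den round u 9 b)) // g2; lia.
set s4' := den (For 24 1 round) s3 in inv4 J0 w4 *.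
have t4 : tables n m r sr tg co (s2 8) s4'.
  by apply: tables_frame t3; rewrite /s4' den_frame.
have a0 b : b < m -> s4' 9 b = 0.
  move=> bm; move: J0; rewrite subnn leqn0 sum_nat_eq0.
  by move/forallP/(_ (Ordinal bm))/eqP.
(* Without live vertices, the paths in the invariant can only end at [r]. *)
have nolive y : ~ live m (fun b y => s2 8 (b * n + y)) (s4' 9) y.
  by move=> [b [bm ab _]]; rewrite a0 in ab.
have out_ok y : y < n -> s4' 5 y != 0 ->
    [/\ (s4' 5 y).-1 < m, sr (s4' 5 y).-1 = y & y != r].
  move=> yn oy; have [b bm e] := inv_out inv4 yn oy.
  have [rho hrho] := nx_ok b bm.
  by rewrite e in oy *; have [] := hrho y yn oy.
have out_r : s4' 5 r = 0.
  by have [//|/(out_ok r r_lt)[_ _]] := eqVneq (s4' 5 r) 0; rewrite eqxx.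
have [||i|f5 f6] := @finish_spec n r s4'.
- exact: (reads_n (tables_reads t4)).
- exact: (reads_r (tables_reads t4)).
- by rewrite /s4' den_frame // /s3 den_frame // z2.
exists (s4' 5); split=> //.
- move=> y yn oy; have [p [x [xn fp [e|/nolive//]]]] := inv_path inv4 yn oy.
  by exists p; rewrite -e.
- move=> v vn sv.
  have wv : s4' 12 v != 0 by apply: w4 => //; rewrite w3 // s24.
  have [p [pn fp]] := inv_tok inv4 vn wv.
  case: (s4' 10 v) => [[e hw]|b [bm ab]]; last by rewrite a0 in ab.
  exists p; first by rewrite -e.
  (* The factor in the final potential is at least 2, which supplies the extra power of two. *)
  apply: leq_trans (inv_pot inv4); rewrite expnSr.
  apply: leq_mul; last by rewrite ltnS leq_maxr.
  apply: leq_trans hw _.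
  by rewrite (bigD1 (Ordinal vn)) //= leq_addr.
- move=> y yn; rewrite f5; have [->|ne] := eqVneq y r.
    by split=> //; left.
  by split=> [|[e|//]]; [right | rewrite e eqxx in ne].
move=> a am; rewrite f6; split=> [[y yn [oy <-]]|oa].
  have [_ -> _] := out_ok y yn oy.
  by rewrite prednK // lt0n.
by exists (sr a); rewrite ?oa //; apply: sr_lt.
Qed.

(** * Arborescences of the input graph *)

Lemma switchesE (V A : finType) (C : eqType) (G : cdigraph V A C) p :
  switches G p = seq_switches [seq color G a | a <- p].
Proof.
rewrite /switches /seq_switches; case: p => //= a p.
by elim: p a => //= b p IH a; rewrite IH.
Qed.

Lemma encode_src n m (G : cdigraph 'I_n 'I_m nat) r R (a : 'I_m) :
  encode G r R 1 a = src G a.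
Proof. by rewrite /encode /= (nth_map a) ?size_enum_ord // nth_ord_enum. Qed.

Lemma encode_tgt n m (G : cdigraph 'I_n 'I_m nat) r R (a : 'I_m) :
  encode G r R 2 a = tgt G a.
Proof. by rewrite /encode /= (nth_map a) ?size_enum_ord // nth_ord_enum. Qed.

Lemma encode_color n m (G : cdigraph 'I_n 'I_m nat) r R (a : 'I_m) :
  encode G r R 3 a = color G a.
Proof. by rewrite /encode /= (nth_map a) ?size_enum_ord // nth_ord_enum. Qed.

Lemma encode_terminal n m (G : cdigraph 'I_n 'I_m nat) r R (v : 'I_n) :
  encode G r R 4 v = (v \in R).
Proof. by rewrite /encode /= (nth_map v) ?size_enum_ord // nth_ord_enum. Qed.

Section OrdinalGraph.
Variables (n m : nat) (G : cdigraph 'I_n 'I_m nat) (r : 'I_n) (R : {set 'I_n}).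
Let sr := encode G r R 1.
Let tg := encode G r R 2.
Let co := encode G r R 3.

Lemma reach_mono b k l v : k <= l -> reach m r sr tg co b k v ->
  reach m r sr tg co b l v.
Proof.
by move/subnK<-; elim: (l - k) => [|d IH] //= h; left; apply: IH.
Qed.

(** The first arc of the monochromatic path represents its color. Shortcutting within the arcs of
    that color gives a simple path, which has fewer than [n] arcs and is thus found by [n]
    passes. *)
Lemma reach_terminal v : valid_instance G r R -> v \in R ->
  exists2 b, b < m & reach m r sr tg co b n v.
Proof.
move=> [rR _ h] vR; have [p [hp mp]] := h v vR.
case: p hp mp => [/eqP vr|a p hp mp]; first by rewrite -vr vR in rR.
exists a => //.
pose e := [rel x y | [exists a' : 'I_m,
  [&& color G a' == color G a, src G a' == x & tgt G a' == y]]].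
have : connect e v r.
  have : all (fun a' => color G a' == color G a) (a :: p).
    by rewrite /= eqxx; move: mp; rewrite /monochromatic /= all_map.
  elim: (a :: p) v hp {vR h mp} => [|a' q IH] v /=; first by move=> /eqP->.
  case/andP=> /eqP sa hq /andP[ca aq]; apply: connect_trans (IH _ hq aq).
  by apply: connect1; apply/existsP; exists a'; rewrite ca sa !eqxx.
case/connectP=> q hq er; case/shortenP: hq er => q' hq' uq' _ er.
apply: (@reach_mono _ (size q')).
  have := card_uniqP uq' => /= sz; have := max_card (mem (v :: q')).
  by rewrite sz card_ord; apply: ltnW.
elim: q' v hq' er {uq' hp vR h} => [|x q' IH] v /=; first by move=> _ ->.
case/andP=> /existsP[a' /and3P[/eqP ca /eqP sa /eqP ta]] hq' er.
right; exists a'; split=> //.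
- by rewrite /co !encode_color.
- by rewrite /sr encode_src sa.
by rewrite /tg encode_tgt ta; apply: IH.
Qed.

Variables (out : nat -> nat) (T : subgraph 'I_n 'I_m).
Hypothesis out_r : out r = 0.
Hypothesis out_follows : forall y : nat, y < n -> out y != 0 ->
  exists p, follows m sr tg out y p r.
Hypothesis vertsE : forall v : 'I_n,
  v \in verts T <-> v = r :> nat \/ out v != 0.
Hypothesis arcsE : forall a : 'I_m, a \in arcs T <-> out (sr a) = a.+1.

Lemma follows_dpath (v : 'I_n) p : follows m sr tg out v p r ->
  exists2 q : seq 'I_m, map val q = p & dpath_in G T v q r.
Proof.
elim: p v => [|a p IH] v /=.
  move=> /eqP/val_inj->; exists [::] => //; split=> //.
    by apply/vertsE; left.
    by apply/vertsE; left.
  exact: eqxx.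
case/and4P=> am /eqP sa /eqP oa.
have -> : a = Ordinal am by [].
rewrite /tg encode_tgt => /IH[q <- [qv qr qT qp]].
have sv : src G (Ordinal am) = v by apply: val_inj;
  rewrite /= -(encode_src G r R).
exists (Ordinal am :: q) => //; split=> //.
- by apply/vertsE; right; rewrite oa.
- move=> a'; rewrite inE => /predU1P[->|/qT//].
  by apply/arcsE; rewrite [sr _]sa oa.
by rewrite /= sv eqxx.
Qed.

(** Through [out], an arc of [T] is determined by its source, and none leaves [r]; so two paths to
    [r] agree arc by arc and stop together. *)
Lemma dpath_in_uniq v q q' :
  dpath_in G T v q r -> dpath_in G T v q' r -> q = q'.
Proof.
have root a : a \in arcs T -> src G a != r.
  move/arcsE => oa; apply/eqP => sa.
  by rewrite /sr encode_src sa out_r in oa.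
case=> _ _ + + [_ _ + +].
elim: q v q' => [|a q IH] v [|a' q'] //=.
- by move=> _ /eqP-> /(_ a' (mem_head _ _))/root/negPf->.
- by move=> /(_ a (mem_head _ _))/root/negPf + + _ /eqP e; rewrite e => ->.
move=> qT /andP[/eqP sa hq] qT' /andP[/eqP sa' hq'].
have /arcsE oa := qT a (mem_head _ _); have /arcsE oa' := qT' a' (mem_head _ _).
have e : a = a'.
  by apply: val_inj; move: oa oa'; rewrite /sr !encode_src sa sa' => -> [].
rewrite e in hq *; congr (_ :: _); apply: IH hq _ hq' => x xq.
  by apply: qT; rewrite inE xq orbT.
by apply: qT'; rewrite inE xq orbT.
Qed.

Lemma out_arborescence : arborescence G r T.
Proof.
have fol v : v \in verts T -> exists p, follows m sr tg out v p r.
  by move/vertsE => [->|/out_follows]; [exists [::]; rewrite /= | apply].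
have fin v : v \in verts T -> exists q, dpath_in G T v q r.
  by case/fol=> p /follows_dpath[q _ hq]; exists q.
split=> [a aT|v vT]; last first.
  have [q hq] := fin v vT; exists q; split=> // q'; exact: dpath_in_uniq.
have /arcsE oa := aT; have sv : src G a \in verts T.
  by apply/vertsE; right; rewrite -(encode_src G r R) oa.
(* The path from the source must begin with this very arc, so its remainder places the target in
   [T]. *)
split=> //; have [p] := fol _ sv; rewrite -(encode_src G r R).
case: p => [|a' p] /=.
  by move=> /eqP sr0; move: oa; rewrite /sr sr0 out_r.
case/and4P=> am _; rewrite oa => /eqP[aa'] fp.
have [|q _ []//] := @follows_dpath (tgt G a) p.
by rewrite -(encode_tgt G r R) aa'.
Qed.

Lemma out_switching (K : realType) (alpha : K) :
  (forall v : 'I_n, v \in R -> exists2 p, follows m sr tg out v p r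
     & ((seq_switches [seq co a | a <- p])%:R <= alpha)%R) ->
  alpha_switching alpha G r R T.
Proof.
move=> h; have path v : v \in R -> exists2 q, dpath_in G T v q r
    & ((switches G q)%:R <= alpha)%R.
  case/h=> p /follows_dpath[q <- hq] sp; exists q => //.
  have e : [seq color G a | a <- q] = map co (map val q).
    by rewrite -map_comp; apply: eq_map => a; rewrite /= /co encode_color.
  by rewrite switchesE e.
split; first exact: out_arborescence.
  by apply/subsetP => v /path[q []].
by move=> v p /path[q hq sq] hp; rewrite (dpath_in_uniq hp hq).
Qed.

End OrdinalGraph.

(** * From powers of two to logarithms *)

Lemma switches_bound (K : realType) (k t : nat) :
  0 < k -> 2 ^ t.+1 <= k * k.+1 ->
  (t%:R <= 2 * (ln (k%:R : K) / ln (4 / 3 : K)))%R.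
Proof.
move=> k0 h.
(* Since k + 1 <= 2k, the extra factor 2 turns k(k+1) into the square of k. *)
have {}h : 2 ^ t <= k ^ 2 by move: h; rewrite expnS; nia.
have l43 : (0 < ln (4 / 3 : K))%R by apply: ln_gt0; lra.
rewrite mulrA ler_pdivlMr //.
have : (ln ((2 ^ t)%:R : K) <= ln ((k ^ 2)%:R : K))%R.
  by rewrite ler_ln ?posrE ?ltr0n ?expn_gt0 ?k0 // ler_nat.
rewrite !natrX !lnXn ?ltr0n //
  -[X in (X <= _)%R]mulr_natl -[X in (_ <= X)%R]mulr_natl => le2.
(* The base 4/3 enters only through ln(4/3) <= ln 2. *)
apply: le_trans le2; apply: ler_wpM2l; first exact: ler0n.
by rewrite ler_ln ?posrE; lra.
Qed.

Lemma arborescence_prog_correct (K : realType) (n m : nat)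
    (G : cdigraph 'I_n 'I_m nat) (r : 'I_n) (R : {set 'I_n}) :
    valid_instance G r R ->
  exists (t : nat) (s : store),
    [/\ exec (compile arborescence_prog) (encode G r R) t s,
        t <= (cost arborescence_prog).[n + m]%R
      & alpha_switching (2 * (ln (#|R|%:R : K) / ln (4 / 3 : K)))%R G r R
          (decode n m s)].
Proof.
move=> valid; have [rR R0 _] := valid.
set s0 := encode G r R.
have s04 v (vn : v < n) : s0 4 v = (Ordinal vn \in R).
  exact: (encode_terminal G r R (Ordinal vn)).
have [||t et lt] := @exec_compile (n + m) arborescence_prog s0 => //.
  move=> [|[|[|j]]]; rewrite /s0 /encode /=; [lia|lia| |by rewrite nth_nil].
  by have := ltn_ord r; lia.
exists t; exists (den arborescence_prog s0); split=> //.
have kE : #|R| = \sum_(v < n) s0 4 v.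
  rewrite -sum1_card big_mkcond; apply: eq_bigr => v _.
  by rewrite /s0 encode_terminal; case: ifP.
have [|||||||out [o1 o2 o3 o4 o5]] := @arborescence_prog_spec n m r
    (s0 1) (s0 2) (s0 3) #|R| s0 (ltn_ord r).
- by move=> a am; rewrite [s0 1 a](encode_src G r R (Ordinal am)).
- by move=> a am; rewrite [s0 2 a](encode_tgt G r R (Ordinal am)).
- by split.
- by move=> [|[|[|[|[|i]]]]] // _ j; rewrite /s0 /encode /= ?nth_nil; case: j.
- by move=> v vn; rewrite (s04 _ vn) leq_b1.
- exact: kE.
- move=> v vn; rewrite (s04 _ vn) eqb0 negbK => vR; split.
    by apply: contraNneq rR => e; rewrite (_ : r = Ordinal vn) //;
      apply: val_inj.
  exact: reach_terminal valid vR.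
apply: (out_switching o1 o2).
- by move=> v; rewrite inE; apply: o4.
- by move=> a; rewrite inE; apply: o5.
move=> v vR; have [|p fp hp] := o3 v (ltn_ord v);
  first by rewrite /s0 encode_terminal vR.
by exists p => //; apply: switches_bound.
Qed.

(** * Arbitrary finite vertex and arc types *)

Section Transport.
Variables (V A : finType) (C : eqType) (G : cdigraph V A C).

(** [C] has only decidable equality, so a color is coded by its first position among the colors of
    the arcs. This is injective on colors that occur. *)
Definition ordinal_color (c : C) : nat := index c [seq color G a | a <- enum A].

Definition ordinal_graph : cdigraph 'I_#|V| 'I_#|A| nat := {|
  src := fun a => enum_rank (src G (enum_val a));
  tgt := fun a => enum_rank (tgt G (enum_val a));
  color := fun a => ordinal_color (color G (enum_val a))
|}.

Lemma dpath_ordinal v p w :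
  dpath ordinal_graph (enum_rank v) (map enum_rank p) (enum_rank w)
    = dpath G v p w.
Proof.
elim: p v => [|a p IH] v /=; first by rewrite (inj_eq enum_rank_inj).
by rewrite enum_rankK (inj_eq enum_rank_inj) IH.
Qed.

Lemma colors_ordinal p :
  [seq color ordinal_graph a | a <- map enum_rank p]
    = map ordinal_color [seq color G a | a <- p].
Proof. by rewrite -!map_comp; apply: eq_map => a /=; rewrite enum_rankK. Qed.

Lemma ordinal_color_inj a b :
  (ordinal_color (color G a) == ordinal_color (color G b))
    = (color G a == color G b).
Proof.
apply/eqP/eqP => [e|->//].
have mem c : color G c \in [seq color G a | a <- enum A].
  by apply: map_f; rewrite mem_enum.
by rewrite -(nth_index (color G a) (mem a)) [index _ _]e nth_index.
Qed.

Lemma switches_ordinal p :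
  switches ordinal_graph (map enum_rank p) = switches G p.
Proof.
rewrite /switches; case: p => //= a p.
elim: p a => //= b p IH a.
by rewrite IH !enum_rankK ordinal_color_inj.
Qed.

Lemma monochromatic_ordinal p :
  monochromatic G p -> monochromatic ordinal_graph (map enum_rank p).
Proof.
rewrite /monochromatic colors_ordinal; case: p => //= a p.
by move=> mp; rewrite all_map; apply: sub_all mp => c /= /eqP->.
Qed.

Lemma valid_ordinal r (R : {set V}) : valid_instance G r R ->
  valid_instance ordinal_graph (enum_rank r) (enum_rank @: R).
Proof.
case=> rR R0 h; split; first by rewrite (mem_imset _ _ enum_rank_inj).
  by rewrite (card_imset _ enum_rank_inj).
move=> _ /imsetP[v vR ->]; have [p [hp mp]] := h v vR.
by exists (map enum_rank p); rewrite dpath_ordinal; split=> //;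
  apply: monochromatic_ordinal.
Qed.

Definition pullback (T : subgraph 'I_#|V| 'I_#|A|) : subgraph V A :=
  Subgraph [set v | enum_rank v \in verts T] [set a | enum_rank a \in arcs T].

Lemma dpath_in_pullback T v p w :
  dpath_in G (pullback T) v p w <->
  dpath_in ordinal_graph T (enum_rank v) (map enum_rank p) (enum_rank w).
Proof.
rewrite /dpath_in dpath_ordinal !inE; split=> -[? ? hp ?]; split=> //.
  by move=> _ /mapP[a /hp + ->]; rewrite inE.
by move=> a ap; rewrite inE; apply: hp; apply: map_f.
Qed.

Lemma alpha_switching_pullback (K : realType) (alpha : K) r (R : {set V}) T :
  alpha_switching alpha ordinal_graph (enum_rank r) (enum_rank @: R) T ->
  alpha_switching alpha G r R (pullback T).
Proof.
case=> -[sub uniq_path] /subsetP RT sw; split; first split.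
- move=> a; rewrite !inE => /sub /=; by rewrite enum_rankK.
- move=> v; rewrite inE => /uniq_path[p [hp up]].
  have pE : map enum_rank (map enum_val p) = p by apply: mapK => a;
    apply: enum_valK.
  exists (map enum_val p); split; first by apply/dpath_in_pullback; rewrite pE.
  move=> q /dpath_in_pullback/up e.
  by rewrite e -map_comp map_id_in // => a _ /=; rewrite enum_rankK.
- by apply/subsetP => v vR; rewrite inE; apply: RT; apply: imset_f.
move=> v p vR /dpath_in_pullback hp; rewrite -switches_ordinal.
by apply: sw hp; apply: imset_f.
Qed.

End Transport.

Local Open Scope ring_scope.

Theorem theorem3p1 (K : realType) :
  (forall (V A : finType) (C : eqType) (G : cdigraph V A C) (r : V)
      (R : {set V}),
    valid_instance G r R ->
    exists T : subgraph V A,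
      alpha_switching (2 * (ln (#|R|%:R : K) / ln (4 / 3 : K))) G r R T)
  /\
  (exists (c : cmd) (q : {poly nat}),
    forall (n m : nat) (G : cdigraph 'I_n 'I_m nat) (r : 'I_n)
      (R : {set 'I_n}),
    valid_instance G r R ->
    exists (t : nat) (s : store),
      [/\ exec c (encode G r R) t s,
          (t <= q.[(n + m)%N])%N
        & alpha_switching (2 * (ln (#|R|%:R : K) / ln (4 / 3 : K))) G r R
            (decode n m s)]).
Proof.
split=> [V A C G r R valid|]; last first.
  by exists (compile arborescence_prog), (cost arborescence_prog) => n m G r R;
    apply: arborescence_prog_correct.
(* Existence for arbitrary types is read off from the run of the program on the relabelled graph. *)
have [t [s [_ _]]] := arborescence_prog_correct K (valid_ordinal valid).
rewrite (card_imset _ (@enum_rank_inj V)) => /alpha_switching_pullback h.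
by exists (pullback (decode #|V| #|A| s)).
Qed.
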